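(* Let $\Bbbk$ be a field of characteristic $0$, $H$ a Hopf $\Bbbk$-algebra, and $L$ a finite-dimensional Lie $\Bbbk$-algebra which is either a left $H$-module Lie algebra or a right $H$-comodule Lie algebra, and which is co-hereditarily tracial as an $H$-(co)module. Then the solvable radical $\mathfrak{r}(L)$ is $H$-invariant (in the module case), respectively $H$-coinvariant (in the comodule case).
   Context: $H$ has comultiplication $h\mapsto h_1\otimes h_2$ (Sweedler notation), counit $\varepsilon$ and antipode $S$. An $H$-(co)module Lie algebra is a Lie algebra that is a left $H$-module (right $H$-comodule) for which the bracket $L\otimes L\to L$ is an $H$-(co)module morphism, tensor products carrying the usual diagonal (co)actions. For a finite-dimensional $H$-(co)module $V$, $\mathrm{End}(V)\cong V\otimes V^*$ carries the induced (co)action, $V^*$ being the left dual: in the module case $(h\cdot T)(v)=h_1\cdot T(S(h_2)\cdot v)$; in the comodule case, writing coactions as $v\mapsto v_0\otimes v_1\in V\otimes H$, $T_0(v)\otimes T_1=T(v_0)_0\otimes T(v_0)_1S(v_1)$. $V$ is tracial if $\mathrm{Tr}:\mathrm{End}(V)\to\Bbbk$ is a morphism of $H$-(co)modules to the trivial (co)module $\Bbbk$. An $H$-(co)module is co-hereditarily tracial if all of its finite-dimensional quotient (co)modules are tracial. The solvable radical $\mathfrak{r}(L)$ is the largest solvable ideal of $L$. A subspace $W\le L$ is $H$-invariant if $H\cdot W\subseteq W$, respectively $H$-coinvariant if the coaction $\rho$ satisfies $\rho(W)\subseteq W\otimes H$. *)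

(* Defs.v *)
From HB Require Import structures.
From mathcomp Require Import all_boot all_order all_algebra.
From mathcomp Require Import boolp.

Set Implicit Arguments.
Unset Strict Implicit.
Unset Printing Implicit Defensive.

Import GRing.Theory.
Local Open Scope ring_scope.
Local Open Scope quotient_scope.

(* Tensor product over K: formal sums of pairs, two of which are identified   *)
(* when every bilinear map takes the same value on them.                      *)
Section Tensor.
Variables (K : fieldType) (V W : lmodType K).

Definition teval (U : lmodType K) (f : V -> W -> U) (s : seq (V * W)) : U :=
  \sum_(x <- s) f x.1 x.2.

Definition teq (s t : seq (V * W)) : bool :=
  `[< forall (U : lmodType K) (f : {bilinear V -> W -> U}),
        teval f s = teval f t >].

Lemma teq_refl : reflexive teq.
Proof. by move=> s; apply/asboolP. Qed.

Lemma teq_sym : symmetric teq.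
Proof.
by move=> s t; apply/asboolP/asboolP => h U f; rewrite h.
Qed.

Lemma teq_trans : transitive teq.
Proof.
by move=> t s u /asboolP h1 /asboolP h2; apply/asboolP => U f; rewrite h1.
Qed.

Definition teq_equiv : equiv_rel (seq (V * W)) :=
  EquivRel teq teq_refl teq_sym teq_trans.

Definition tensor := {eq_quot teq_equiv}.
HB.instance Definition _ := Choice.on tensor.
HB.instance Definition _ := EqQuotient.on tensor.

Definition tlift (U : lmodType K) (f : {bilinear V -> W -> U}) (x : tensor) : U :=
  teval f (repr x).

Lemma tlift_pi (U : lmodType K) (f : {bilinear V -> W -> U}) s :
  tlift f (\pi_tensor s) = teval f s.
Proof.
have /eqmodP/asboolP h : repr (\pi_tensor s) = s %[mod tensor] by rewrite reprK.
exact: h.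
Qed.

Lemma tensorP (x y : tensor) :
  (forall (U : lmodType K) (f : {bilinear V -> W -> U}), tlift f x = tlift f y) ->
  x = y.
Proof.
move=> h; rewrite -[x]reprK -[y]reprK; apply/eqmodP; apply/asboolP => U f.
exact: h.
Qed.

Definition tzero : tensor := \pi_tensor [::].
Definition tadd (x y : tensor) : tensor := \pi_tensor (repr x ++ repr y).
Definition tscale (a : K) (x : tensor) : tensor :=
  \pi_tensor [seq (a *: p.1, p.2) | p <- repr x].
Definition topp (x : tensor) : tensor := tscale (-1) x.

Lemma tlift0 (U : lmodType K) (f : {bilinear V -> W -> U}) : tlift f tzero = 0.
Proof. by rewrite tlift_pi /teval big_nil. Qed.

Lemma tliftD (U : lmodType K) (f : {bilinear V -> W -> U}) x y :
  tlift f (tadd x y) = tlift f x + tlift f y.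
Proof. by rewrite tlift_pi /teval big_cat. Qed.

Lemma tliftZ (U : lmodType K) (f : {bilinear V -> W -> U}) a x :
  tlift f (tscale a x) = a *: tlift f x.
Proof.
rewrite tlift_pi /teval big_map /tlift /teval scaler_sumr.
by apply: eq_bigr => p _ /=; rewrite linearZl_LR.
Qed.

Lemma taddA : associative tadd.
Proof. by move=> x y z; apply: tensorP => U f; rewrite !tliftD addrA. Qed.
Lemma taddC : commutative tadd.
Proof. by move=> x y; apply: tensorP => U f; rewrite !tliftD addrC. Qed.
Lemma tadd0 : left_id tzero tadd.
Proof. by move=> x; apply: tensorP => U f; rewrite tliftD tlift0 add0r. Qed.
Lemma taddN : left_inverse tzero topp tadd.
Proof.
move=> x; apply: tensorP => U f.
by rewrite tliftD tlift0 tliftZ scaleN1r addNr.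
Qed.

HB.instance Definition _ :=
  GRing.isZmodule.Build tensor taddA taddC tadd0 taddN.

Lemma tscaleA a b x : tscale a (tscale b x) = tscale (a * b) x.
Proof. by apply: tensorP => U f; rewrite !tliftZ scalerA. Qed.
Lemma tscale1 : left_id 1 tscale.
Proof. by move=> x; apply: tensorP => U f; rewrite tliftZ scale1r. Qed.
Lemma tscaleDr : right_distributive tscale +%R.
Proof.
by move=> a x y; apply: tensorP => U f; rewrite !(tliftD, tliftZ) scalerDr.
Qed.
Lemma tscaleDl x : {morph tscale^~ x : a b / a + b}.
Proof.
by move=> a b; apply: tensorP => U f; rewrite !(tliftD, tliftZ) scalerDl.
Qed.

HB.instance Definition _ := GRing.Zmodule_isLmodule.Build K tensor
  tscaleA tscale1 tscaleDr tscaleDl.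

Lemma tlift_is_linear (U : lmodType K) (f : {bilinear V -> W -> U}) :
  linear (tlift f).
Proof. by move=> a x y; rewrite (tliftD f) (tliftZ f). Qed.
HB.instance Definition _ (U : lmodType K) (f : {bilinear V -> W -> U}) :=
  GRing.isLinear.Build K tensor U _ (tlift f) (tlift_is_linear f).

Definition tens (v : V) (w : W) : tensor := \pi_tensor [:: (v, w)].

Lemma tlift_tens (U : lmodType K) (f : {bilinear V -> W -> U}) v w :
  tlift f (tens v w) = f v w.
Proof. by rewrite tlift_pi /teval big_seq1. Qed.

Lemma tens_is_bilinear : bilinear_for *:%R *:%R tens.
Proof.
split=> [w a x y|v a x y]; apply: tensorP => U f;
  by rewrite linearP /= !tlift_tens ?linearPl ?linearPr.
Qed.
HB.instance Definition _ :=
  bilinear_isBilinear.Build K V W tensor _ _ tens tens_is_bilinear.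

Lemma tensor_sum (x : tensor) : x = \sum_(p <- repr x) tens p.1 p.2.
Proof.
apply: tensorP => U f; rewrite linear_sum /=.
by apply: eq_bigr => p _; rewrite tlift_tens.
Qed.

Lemma tensor_ext (U : lmodType K) (f g : {linear tensor -> U}) :
  (forall v w, f (tens v w) = g (tens v w)) -> f =1 g.
Proof.
by move=> h x; rewrite (tensor_sum x) !linear_sum; apply: eq_bigr => p _.
Qed.

End Tensor.

Notation "V ⊗ W" := (tensor V W) (at level 40, left associativity).
Notation "v ⊗ₜ w" := (tens v w) (at level 40, left associativity) : ring_scope.

Section Maps.
Variable K : fieldType.
Implicit Types A B C V W U : lmodType K.

Definition bicomp A B V W U (h : {bilinear V -> W -> U})
  (f : {linear A -> V}) (g : {linear B -> W}) (a : A) (b : B) : U := h (f a) (g b).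

Lemma bicomp_is_bilinear A B V W U (h : {bilinear V -> W -> U})
  (f : {linear A -> V}) (g : {linear B -> W}) :
  bilinear_for *:%R *:%R (bicomp h f g).
Proof.
by split=> [w a x y|v a x y]; rewrite /bicomp linearP ?linearPl ?linearPr.
Qed.
HB.instance Definition _ A B V W U (h : {bilinear V -> W -> U})
  (f : {linear A -> V}) (g : {linear B -> W}) :=
  bilinear_isBilinear.Build K A B U _ _ (bicomp h f g) (bicomp_is_bilinear h f g).

Definition tmap A B V W (f : {linear A -> V}) (g : {linear B -> W}) :
  A ⊗ B -> V ⊗ W := tlift (bicomp (@tens K V W) f g).
HB.instance Definition _ A B V W (f : {linear A -> V}) (g : {linear B -> W}) :=
  GRing.Linear.on (tmap f g).

Lemma tmap_tens A B V W (f : {linear A -> V}) (g : {linear B -> W}) a b :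
  tmap f g (a ⊗ₜ b) = f a ⊗ₜ g b.
Proof. exact: tlift_tens. Qed.

Definition scalel V (c : K^o) (v : V) : V := c *: v.
Definition scaler V (v : V) (c : K^o) : V := c *: v.
Lemma scalel_is_bilinear V : bilinear_for *:%R *:%R (@scalel V).
Proof.
split=> [w a x y|v a x y]; rewrite /scalel /=.
  by rewrite scalerDl scalerA.
by rewrite scalerDr !scalerA mulrC.
Qed.
Lemma scaler_is_bilinear V : bilinear_for *:%R *:%R (@scaler V).
Proof.
by case: (scalel_is_bilinear V) => hl hr; split.
Qed.
HB.instance Definition _ V :=
  bilinear_isBilinear.Build K K^o V V _ _ (@scalel V) (scalel_is_bilinear V).
HB.instance Definition _ V :=
  bilinear_isBilinear.Build K V K^o V _ _ (@scaler V) (scaler_is_bilinear V).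

(* (x ⊗ y) ⊗ z |-> x ⊗ (y ⊗ z) *)
Definition assoc_aux V W U (x : V ⊗ W) (z : U) : V ⊗ (W ⊗ U) :=
  tmap idfun (applyr (@tens K W U) z) x.
Lemma assoc_aux_is_bilinear V W U : bilinear_for *:%R *:%R (@assoc_aux V W U).
Proof.
split=> [z a x y|x a z t]; first exact: linearP.
rewrite /assoc_aux (tensor_sum x) !linear_sum /= scaler_sumr -big_split /=.
apply: eq_bigr => p _; rewrite !tmap_tens /=.
by rewrite !linearPr.
Qed.
HB.instance Definition _ V W U := bilinear_isBilinear.Build K _ _ _ _ _ (@assoc_aux V W U) (assoc_aux_is_bilinear V W U).
Definition tassoc V W U : (V ⊗ W) ⊗ U -> V ⊗ (W ⊗ U) := tlift (@assoc_aux V W U).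
HB.instance Definition _ V W U := GRing.Linear.on (@tassoc V W U).

Lemma tassoc_tens V W U (v : V) (w : W) (u : U) :
  tassoc ((v ⊗ₜ w) ⊗ₜ u) = v ⊗ₜ (w ⊗ₜ u).
Proof. by rewrite /tassoc tlift_tens /= /assoc_aux tmap_tens. Qed.

(* (a ⊗ₜ a', b ⊗ₜ b') |-> f a b ⊗ₜ g a' b' *)
Section Tmap2.
Variables (A B C A' B' C' : lmodType K).
Variables (f : {bilinear A -> B -> C}) (g : {bilinear A' -> B' -> C'}).

Definition tmap2_aux (y : B ⊗ B') (a : A) (a' : A') : C ⊗ C' :=
  tmap (f a) (g a') y.
Lemma tmap2_aux_is_bilinear y : bilinear_for *:%R *:%R (tmap2_aux y).
Proof.
split=> [a' c u v|a c u v];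
  rewrite /tmap2_aux (tensor_sum y) !linear_sum /= scaler_sumr -big_split /=;
  apply: eq_bigr => p _; rewrite !tmap_tens /=.
  by rewrite !linearPl.
by rewrite linearPl linearPr.
Qed.
HB.instance Definition _ y := bilinear_isBilinear.Build K A A' _ _ _
  (tmap2_aux y) (tmap2_aux_is_bilinear y).

Definition tmap2 (x : A ⊗ A') (y : B ⊗ B') : C ⊗ C' := tlift (tmap2_aux y) x.
Lemma tmap2_is_bilinear : bilinear_for *:%R *:%R tmap2.
Proof.
split=> [y a u v|x a u v]; first exact: linearP.
rewrite /tmap2 (tensor_sum x) !linear_sum /= scaler_sumr -big_split /=.
by apply: eq_bigr => p _; rewrite !tlift_tens /= /tmap2_aux linearP.
Qed.
HB.instance Definition _ := bilinear_isBilinear.Build K _ _ _ _ _ tmap2 tmap2_is_bilinear.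

Lemma tmap2_tens a a' b b' : tmap2 (a ⊗ₜ a') (b ⊗ₜ b') = f a b ⊗ₜ g a' b'.
Proof. by rewrite /tmap2 tlift_tens /= /tmap2_aux tmap_tens. Qed.
End Tmap2.

Definition amul (A : algType K) (x y : A) : A := x * y.
Lemma amul_is_bilinear (A : algType K) : bilinear_for *:%R *:%R (@amul A).
Proof.
split=> [y a u v|x a u v]; rewrite /amul /=.
  by rewrite mulrDl scalerAl.
by rewrite mulrDr scalerAr.
Qed.
HB.instance Definition _ (A : algType K) :=
  bilinear_isBilinear.Build K A A A _ _ (@amul A) (amul_is_bilinear A).

End Maps.

HB.mixin Record isHopf (K : fieldType) H of GRing.Algebra K H := {
  comul : {linear H -> H ⊗ H};
  counit : {linear H -> K^o};
  antipode : {linear H -> H};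
  comulA : forall h,
    tassoc (tmap comul idfun (comul h)) = tmap idfun comul (comul h);
  counitl : forall h, tlift (bicomp (@scalel K H) counit idfun) (comul h) = h;
  counitr : forall h, tlift (bicomp (@scaler K H) idfun counit) (comul h) = h;
  comul1 : comul 1 = 1 ⊗ₜ 1;
  comulM : forall a b,
    comul (a * b) = tmap2 (@amul K H) (@amul K H) (comul a) (comul b);
  counit1 : counit 1 = 1;
  counitM : forall a b, counit (a * b) = counit a * counit b;
  antipodel : forall h,
    tlift (bicomp (@amul K H) antipode idfun) (comul h) = (counit h)%:A;
  antipoder : forall h,
    tlift (bicomp (@amul K H) idfun antipode) (comul h) = (counit h)%:A
}.
#[short(type="hopfAlgType")]
HB.structure Definition HopfAlgebra (K : fieldType) :=
  {H of GRing.Algebra K H & isHopf K H}.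

HB.mixin Record isLie (K : fieldType) L of Vector K L := {
  lie : {bilinear L -> L -> L};
  liexx : forall x, lie x x = 0;
  lieJ : forall x y z, lie x (lie y z) + lie y (lie z x) + lie z (lie x y) = 0
}.
#[short(type="finLieAlgType")]
HB.structure Definition FinLieAlgebra (K : fieldType) :=
  {L of Vector K L & isLie K L}.

Section Radical.
Variables (K : fieldType) (L : finLieAlgType K).
Implicit Types U V W I J R : {vspace L}.

Definition lieV U V : {vspace L} :=
  <<[seq lie u v | u <- vbasis U, v <- vbasis V]>>%VS.

Lemma lieV_sub U V W :
  reflect {in U & V, forall u v, lie u v \in W} (lieV U V <= W)%VS.
Proof.
apply: (iffP span_subvP) => [h u v Uu Vv|h x].
  rewrite (coord_vbasis Uu) (coord_vbasis Vv) linear_sumr rpred_sum // => i _.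
  rewrite linear_sumlz rpred_sum //= => j _.
  rewrite linearZr_LR linearZl_LR !rpredZ //=; apply: h.
  by apply: allpairs_f; apply: mem_nth; rewrite size_tuple.
by case/allpairsP=> -[u v] /= [/vbasis_mem Uu /vbasis_mem Vv ->]; apply: h.
Qed.

Definition derived n U : {vspace L} := iter n (fun X => lieV X X) U.
Definition is_solvable U : Prop := exists n, derived n U = 0%VS.
Definition is_ideal I : Prop := forall x y, y \in I -> lie x y \in I.

Definition is_radical R : Prop :=
  [/\ is_ideal R, is_solvable R &
      forall I, is_ideal I -> is_solvable I -> (I <= R)%VS].

Lemma lieVS U U' V V' :
  (U <= U')%VS -> (V <= V')%VS -> (lieV U V <= lieV U' V')%VS.
Proof.
move=> /subvP sU /subvP sV; apply/lieV_sub => u v /sU Uu /sV Vv.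
exact: (lieV_sub _ _ _ (subvv _)).
Qed.

Lemma derivedS n U V : (U <= V)%VS -> (derived n U <= derived n V)%VS.
Proof. by move=> sUV; elim: n => //= n IH; apply: lieVS. Qed.

Lemma lieC (x y : L) : lie x y = - lie y x.
Proof.
have /eqP := liexx (x + y).
rewrite linearDl !linearDr /= !liexx add0r addr0 addr_eq0 => /eqP ->.
by rewrite ?opprK.
Qed.

Lemma derived_add n I J : is_ideal J ->
  (derived n (I + J) <= derived n I + J)%VS.
Proof.
move=> iJ; elim: n => //= n IH; apply: subv_trans (lieVS IH IH) _.
apply/lieV_sub => _ _ /memv_addP[u Uu [v Jv ->]] /memv_addP[u' Uu' [v' Jv' ->]].
rewrite linearDl !linearDr /= -addrA memv_add //.
  exact: (lieV_sub _ _ _ (subvv _)).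
by apply: rpredD; [|apply: rpredD]; [exact: iJ | rewrite lieC rpredN; exact: iJ |
  exact: iJ].
Qed.

Lemma ideal_add I J : is_ideal I -> is_ideal J -> is_ideal (I + J)%VS.
Proof.
move=> iI iJ x _ /memv_addP[u Iu [v Jv ->]].
by rewrite linearDr memv_add ?iI ?iJ.
Qed.

Lemma solvable_add I J :
  is_ideal J -> is_solvable I -> is_solvable J -> is_solvable (I + J)%VS.
Proof.
move=> iJ [n In] [m Jm]; exists (m + n)%N.
apply/eqP; rewrite -subv0 -Jm /derived iterD; apply: derivedS.
by apply: subv_trans (derived_add n I iJ) _; rewrite In add0v.
Qed.

Lemma radical_exists : exists R, is_radical R.
Proof.
have solv0 : is_solvable 0%VS by exists 0%N.
have ideal0 : is_ideal 0%VS.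
  by move=> x y; rewrite memv0 => /eqP ->; rewrite linear0r mem0v.
pose P n := `[< exists I, [/\ is_ideal I, is_solvable I & \dim I = n] >].
have exP : exists n, P n by exists 0%N; apply/asboolP; exists 0%VS; rewrite dimv0.
have ubP n : P n -> (n <= \dim {:L})%N.
  by move=> /asboolP[I [_ _ <-]]; rewrite dimvS ?subvf.
case: (ex_maxnP exP ubP) => n /asboolP[R [iR sR dR]] maxn.
exists R; split=> // I iI sI.
have : (R == I + R)%VS.
  rewrite eqEdim addvSr /= dR; apply: maxn; apply/asboolP; exists (I + R)%VS.
  by split=> //; [apply: ideal_add | apply: solvable_add].
by move/eqP->; rewrite addvSl.
Qed.

Definition radical : {vspace L} := sval (cid radical_exists).

Lemma radicalP : is_radical radical.
Proof. exact: svalP (cid radical_exists). Qed.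

End Radical.

Section Structures.
Variables (K : fieldType) (H : hopfAlgType K).

Record hmodule (V : lmodType K) := HModule {
  hact :> {bilinear H -> V -> V};
  hact1 : forall v, hact 1 v = v;
  hactM : forall a b v, hact (a * b) v = hact a (hact b v)
}.

Record hcomodule (V : lmodType K) := HComodule {
  hcoact :> {linear V -> V ⊗ H};
  hcoactA : forall v,
    tassoc (tmap hcoact idfun (hcoact v)) = tmap idfun comul (hcoact v);
  hcoact_counit : forall v,
    tlift (bicomp (@scaler K V) idfun counit) (hcoact v) = v
}.

(* h . (v ⊗ w) = h_1 . v ⊗ h_2 . w *)
Definition diag_act (V W : lmodType K) (aV : hmodule V) (aW : hmodule W)
  (h : H) (t : V ⊗ W) : V ⊗ W := tmap2 aV aW (comul h) t.

(* v ⊗ w |-> (v_0 ⊗ w_0) ⊗ v_1 w_1 *)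
Definition diag_coact (V W : lmodType K) (rV : hcomodule V) (rW : hcomodule W) :
  V ⊗ W -> (V ⊗ W) ⊗ H :=
  tlift (bicomp (tmap2 (@tens K V W) (@amul K H)) rV rW).

Definition bracket (L : finLieAlgType K) : L ⊗ L -> L := tlift lie.
HB.instance Definition _ (L : finLieAlgType K) := GRing.Linear.on (@bracket L).

Definition hmodule_lie (L : finLieAlgType K) (a : hmodule L) : Prop :=
  forall h t, bracket (diag_act a a h t) = a h (bracket t).

Definition hcomodule_lie (L : finLieAlgType K) (r : hcomodule L) : Prop :=
  forall t, tmap (@bracket L) idfun (diag_coact r r t) = r (bracket t).

Section Tracial.
Variable V : vectType K.

Definition trace (T : 'End(V)) : K^o :=
  \sum_(i < \dim {:V}) coord (vbasis {:V}) i (T (vbasis {:V})`_i).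
Lemma trace_is_linear : linear trace.
Proof.
move=> a S T; rewrite /trace scaler_sumr -big_split; apply: eq_bigr => i _ /=.
by rewrite add_lfunE scale_lfunE linearP.
Qed.
HB.instance Definition _ := GRing.isLinear.Build K 'End(V) K^o _ trace
  trace_is_linear.

Section EndModule.
Variable a : hmodule V.

Definition sandwich (T : 'End(V)) (x y : H) : 'End(V) :=
  (linfun (a x) \o T \o linfun (a y))%VF.
Lemma sandwich_is_bilinear T : bilinear_for *:%R *:%R (sandwich T).
Proof.
split=> [y c u v|x c u v]; apply/lfunP => w;
  rewrite add_lfunE scale_lfunE !comp_lfunE !lfunE /=.
  by rewrite linearPl.
by rewrite linearPl !linearP.
Qed.
HB.instance Definition _ T := bilinear_isBilinear.Build K H H 'End(V) _ _
  (sandwich T) (sandwich_is_bilinear T).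

(* (h . T)(v) = h_1 . T (S (h_2) . v) *)
Definition end_act (h : H) (T : 'End(V)) : 'End(V) :=
  tlift (bicomp (sandwich T) idfun antipode) (comul h).

Definition hmodule_tracial : Prop :=
  forall h T, trace (end_act h T) = counit h * trace T.
End EndModule.

Section EndComodule.
Variable r : hcomodule V.

Definition rmulT (t : V ⊗ H) (x : H) : V ⊗ H := tmap idfun (applyr (@amul K H) x) t.
Lemma rmulT_is_bilinear : bilinear_for *:%R *:%R rmulT.
Proof.
split=> [x a u v|t a x y]; first exact: linearP.
rewrite /rmulT (tensor_sum t) !linear_sum /= scaler_sumr -big_split /=.
by apply: eq_bigr => p _; rewrite !tmap_tens /= !linearPr.
Qed.
HB.instance Definition _ := bilinear_isBilinear.Build K _ _ _ _ _
  rmulT rmulT_is_bilinear.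

(* v |-> T(v_0)_0 ⊗ T(v_0)_1 S(v_1) *)
Definition end_coact_at (T : 'End(V)) (v : V) : V ⊗ H :=
  tlift (bicomp rmulT (r \o T) antipode) (r v).
Lemma end_coact_at_is_linear T : linear (end_coact_at T).
Proof. by move=> a u v; rewrite /end_coact_at !linearP. Qed.
HB.instance Definition _ T := GRing.isLinear.Build K _ _ _
  (end_coact_at T) (end_coact_at_is_linear T).

Definition dyad_fun (i : 'I_(\dim {:V})) (x v : V) : V :=
  coord (vbasis {:V}) i v *: x.
Lemma dyad_fun_is_linear i x : linear (dyad_fun i x).
Proof. by move=> a u v; rewrite /dyad_fun linearP /= scalerDl scalerA. Qed.
HB.instance Definition _ i x := GRing.isLinear.Build K V V _ (dyad_fun i x)
  (dyad_fun_is_linear i x).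
Definition dyad (i : 'I_(\dim {:V})) (x : V) : 'End(V) := linfun (dyad_fun i x).
Lemma dyadE i x v : dyad i x v = coord (vbasis {:V}) i v *: x.
Proof. by rewrite lfunE. Qed.
Lemma dyad_is_linear i : linear (dyad i).
Proof.
move=> c x y; apply/lfunP => v.
by rewrite add_lfunE scale_lfunE !dyadE scalerDr !scalerA mulrC.
Qed.
HB.instance Definition _ i := GRing.isLinear.Build K V 'End(V) _ (dyad i)
  (dyad_is_linear i).

(* The preimage of [end_coact_at T] under End(V) ⊗ H ≅ Hom(V, V ⊗ H);         *)
(* it is characterised by [end_coactE].                                       *)
Definition end_coact (T : 'End(V)) : 'End(V) ⊗ H :=
  \sum_(i < \dim {:V}) tmap (dyad i) idfun (end_coact_at T (vbasis {:V})`_i).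

Definition eval_at (v : V) (T : 'End(V)) : V := T v.
Lemma eval_at_is_linear v : linear (eval_at v).
Proof. by move=> a S T; rewrite /eval_at add_lfunE scale_lfunE. Qed.
HB.instance Definition _ v := GRing.isLinear.Build K 'End(V) V _ (eval_at v)
  (eval_at_is_linear v).

Lemma end_coactE T v : tmap (eval_at v) idfun (end_coact T) = end_coact_at T v.
Proof.
rewrite [in RHS](coord_vbasis (memvf v)) /end_coact !linear_sum.
apply: eq_bigr => i _ /=; rewrite linearZ /=.
move: (end_coact_at _ _) => t.
rewrite (tensor_sum t) [tmap (dyad i) _ _]linear_sum [LHS]linear_sum scaler_sumr.
apply: eq_bigr => p _; rewrite /= !tmap_tens /= /eval_at dyadE.
by rewrite linearZl_LR.
Qed.

Definition hcomodule_tracial : Prop :=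
  forall T, tmap trace idfun (end_coact T) = trace T ⊗ₜ 1.
End EndComodule.
End Tracial.

(* A quotient (co)module is given as the target of a surjective morphism.     *)
Definition hmodule_coher_tracial (V : lmodType K) (a : hmodule V) : Prop :=
  forall (Q : vectType K) (aQ : hmodule Q) (p : {linear V -> Q}),
    (forall h v, p (a h v) = aQ h (p v)) ->
    (forall q, exists v, p v = q) ->
    hmodule_tracial aQ.

Definition hcomodule_coher_tracial (V : lmodType K) (r : hcomodule V) : Prop :=
  forall (Q : vectType K) (rQ : hcomodule Q) (p : {linear V -> Q}),
    (forall v, tmap p idfun (r v) = rQ (p v)) ->
    (forall q, exists v, p v = q) ->
    hcomodule_tracial rQ.

Definition hinvariant (V : vectType K) (a : hmodule V) (W : {vspace V}) : Prop :=
  forall h w, w \in W -> a h w \in W.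

(* t lies in the image of W ⊗ H in V ⊗ H *)
Definition in_tensorl (V : vectType K) (W : {vspace V}) (t : V ⊗ H) : Prop :=
  exists s : subvs_of W ⊗ H, t = tmap (@vsval K V W) idfun s.

Definition hcoinvariant (V : vectType K) (r : hcomodule V) (W : {vspace V}) : Prop :=
  forall w, w \in W -> in_tensorl W (r w).

End Structures.

(* Main.v *)
Require Import Defs.
From mathcomp Require Import all_boot all_order all_algebra.
From HB Require Import structures.
From mathcomp Require Import all_field ssrAC ring boolp.

(** Why the theorem holds.  Let [M] be an invariant solvable ideal of [L].  The
    algebra [L] acts on [Q = L / M] by the adjoint action, which gives the
    symmetric invariant form [kappa x y = Tr_Q (ad x \o ad y)].  Its radical
    [N] is an ideal that contains [M], and three facts about it are combined.

    - [N] is invariant under the (co)action ([killing_radical_hinvariant],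
      [killing_radical_hcoinvariant]).  The map [ad : L -> End(Q)] is a morphism
      of (co)modules and composition is equivariant, so traciality of [Q] gives
      [kappa (h_1 x) (h_2 y) = eps(h) kappa x y].  The antipode then yields
      [kappa (h x) y = kappa (h_1 x) (h_2 S(h_3) y) = kappa x (S(h) y)], which
      vanishes when [x] lies in [N].  For a coaction, in the same way,
      [kappa (x_0) y x_1 = kappa (x_0) (y_0) x_1 y_1 S(y_2)
                         = kappa x (y_0) S(y_1)].
    - [N] is solvable ([killing_radical_solvable]).  This is Cartan's criterion,
      applied to a stable term [D = [D, D]] of the derived series of [N].
    - If [N = M], then [M] is the solvable radical
      ([radical_sub_of_killing]): otherwise the last term [A] of the derived
      series of the radical that is not inside [M] is abelian modulo [M], so
      [(ad a \o ad y)^2 = 0] on [Q] for [a] in [A], whence [A <= N = M].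

    Choosing [M] of largest dimension among the invariant solvable ideals forces
    [N = M], and hence the radical is [M] ([radical_invariant]).

    Cartan's criterion takes this form: a perfect Lie algebra [g] of matrices over
    a field of characteristic 0 with [tr (a b) = 0] on [g] is zero
    ([perfect_trace0]).  Each [x] in [[g, g]] is shown to be nilpotent, and by
    Engel's theorem [g] is then contained in [g * g], ..., [g ^ n = 0].

    For the nilpotency of [x], pass to a field [E] over which the characteristic
    polynomial of [x] splits, with distinct roots [mu_i] and spectral projections
    [Pi_i], the latter polynomials in [x].  The classical argument takes a
    [Q]-linear functional on the span of the [mu_i]; here it is a
    rational vector [w] orthogonal to every rational relation
    between the [mu_i].  Put [y = \sum_i w_i Pi_i].  As [w_i - w_j] depends only
    on [mu_i - mu_j], the operator [ad y] is a polynomial in [ad x], so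
    [tr ([a, b] y)] is a combination of the numbers [tr (a (ad x)^k b)], all zero.
    Thus [0 = tr (x y) = \sum_i w_i n_i mu_i] where [n_i] is the rank of [Pi_i].
    So [(w_i n_i)_i] is itself a relation, hence orthogonal to [w]:
    [\sum_i n_i w_i ^ 2 = 0], which forces [w_i = 0] whenever [Pi_i] is nonzero.
    Consequently such a [mu_i] is subject to the relation [mu_i = 0]. *)

Set Implicit Arguments.
Unset Strict Implicit.
Unset Printing Implicit Defensive.

Import GRing.Theory Num.Theory.
Local Open Scope ring_scope.

(** * Engel's theorem for associatively nilpotent spaces *)

Section Engel.
Variables (K : fieldType) (A : falgType K).
Implicit Types (g k U : {vspace A}) (x y : A).

Definition comm_closed g := {in g &, forall x y, x * y - y * x \in g}.

(** Since [y] normalises [k], letters of [k] can be moved to the right through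
    [y]: with [B] the algebra generated by [k] and [y], [k * B <= B * k]. Hence a
    word of length [m] is in [<[y ^ m]> + B * k = B * k], and a product of [n.+1]
    such words is in [(B * k) ^ n.+1 <= B * k ^ n.+1 = 0]. *)
Lemma expv_adjoin_nilp k y n m : (k ^+ n.+1 = 0)%VS -> y ^+ m = 0 ->
  (forall a, a \in k -> a * y - y * a \in k) ->
  ((k + <[y]>) ^+ (m * n.+1) = 0)%VS.
Proof.
move=> kn ym nky; set B := agenv (k + <[y]>).
have sB : (k + <[y]> <= B)%VS by exact: sub_agenv.
have kB : (k <= B)%VS by apply: subv_trans sB; apply: addvSl.
have yB : (<[y]> <= B)%VS by apply: subv_trans sB; apply: addvSr.
have BB : (B * B = B)%VS by exact: agenvM.
have BBk U : (B * (B * U) = B * U)%VS by rewrite prodvA BB.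
have kBk : (k <= B * k)%VS.
  by rewrite -[X in (X <= _)%VS]prod1v prodvSl // sub1_agenv.
have kk_sub : (k * B <= B * k)%VS.
  apply: subv_trans (prodvSl _ kBk) _.
  apply: agenv_modr; rewrite -prodvA prodvDr prodvDr subv_add; apply/andP; split.
    by rewrite -[X in (_ <= X)%VS]BBk prodvSr // prodvSl.
  rewrite -[X in (_ <= X)%VS]BBk prodvSr //; apply/prodvP => a b ka /vlineP[c ->].
  rewrite -scalerAr memvZ // -[a * y](subrK (y * a)) rpredD //.
    by apply: (subvP kBk); apply: nky.
  by apply: memv_mul => //; apply: (subvP yB); apply: memv_line.
have BkX i : ((B * k) ^+ i.+1 <= B * k ^+ i.+1)%VS.
  elim: i => [|i IH]; first by rewrite !expv1.
  rewrite expvSl; apply: subv_trans (prodvSr _ IH) _.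
  rewrite -prodvA; apply: subv_trans (prodvSr _ _) _.
    by rewrite prodvA; apply: prodvSl kk_sub.
  by rewrite -prodvA -expvSl BBk.
have split_word i : ((k + <[y]>) ^+ i <= <[y ^+ i]> + B * k)%VS.
  elim: i => [|i IH]; first by rewrite !expv0 expr0 addvSl.
  rewrite expvSl; apply: subv_trans (prodvSr _ IH) _.
  rewrite prodvDl prodvDr prodvDr !subv_add -!andbA; apply/and4P; split.
  - apply: subv_trans (addvSr _ _); apply: subv_trans kk_sub; rewrite prodvSr //.
    rewrite -expv_line; apply: subv_trans (subX_agenv _ i).
    exact/expvS/addvSr.
  - by apply: subv_trans (addvSr _ _); rewrite -[X in (_ <= X)%VS]BBk prodvSl.
  - by rewrite prodv_line -exprS addvSl.
  - by apply: subv_trans (addvSr _ _); rewrite -[X in (_ <= X)%VS]BBk prodvSl.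
apply/eqP; rewrite -subv0 expvM.
have := expvS n.+1 (split_word m); rewrite ym => /subv_trans; apply.
have -> : (<[0]> + B * k = B * k)%VS.
  by rewrite (_ : <[0 : A]>%VS = 0%VS) ?add0v //; apply/eqP; rewrite -subv0 -memvE mem0v.
by apply: subv_trans (BkX n) _; rewrite kn prodv0.
Qed.

Fixpoint ad_word (s : seq A) (z : A) : A :=
  if s is a :: s' then let w := ad_word s' z in a * w - w * a else z.

Lemma ad_wordD s y z : ad_word s (y + z) = ad_word s y + ad_word s z.
Proof. by elim: s => //= a s ->; rewrite mulrDr mulrDl addrACA opprD. Qed.
Lemma ad_wordN s y : ad_word s (- y) = - ad_word s y.
Proof. by elim: s => //= a s ->; rewrite mulrN mulNr -opprD. Qed.
Lemma ad_word_rcons s a z : ad_word (rcons s a) z = ad_word s (a * z - z * a).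
Proof. by elim: s => //= b s ->. Qed.

(** Expanding the brackets gives terms [u * z * v] with [size s] letters in
    [u] and [v] together; when [size s] is at least [2 n - 1], one of
    [u] and [v] has [n] letters. *)
Lemma ad_word_nilp k n s z : (k ^+ n = 0)%VS -> {subset s <= k} ->
  (n + n <= (size s).+1)%N -> ad_word s z = 0.
Proof.
move=> kn.
suffices gen p q u v : u \in (k ^+ p)%VS -> v \in (k ^+ q)%VS ->
    {subset s <= k} -> (n + n <= (size s + p + q).+1)%N ->
    ad_word s (u * z * v) = 0.
  move=> sk ns; rewrite -[z]mulr1 -[z]mul1r; apply: (gen 0 0)%N => //.
  - by rewrite expv0 memv_line.
  - by rewrite expv0 memv_line.
  - by rewrite !addn0.
elim/last_ind: s p q u v => [|s a IH] p q u v up vq sk ns.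
  have [le_np|lt_pn] := leqP n p.
    suff -> : u = 0 by rewrite !mul0r.
    by apply/eqP; rewrite -memv0; move: up; rewrite -(subnKC le_np) expvD kn prod0v.
  have [le_nq|lt_qn] := leqP n q.
    suff -> : v = 0 by rewrite mulr0.
    by apply/eqP; rewrite -memv0; move: vq; rewrite -(subnKC le_nq) expvD kn prod0v.
  by move: ns; rewrite add0n leqNgt -addSn -addnS leq_add.
have ka : a \in k by apply: sk; rewrite mem_rcons inE eqxx.
have sk' : {subset s <= k} by move=> b sb; apply: sk; rewrite mem_rcons inE sb orbT.
rewrite size_rcons in ns.
rewrite ad_word_rcons ad_wordD ad_wordN !mulrA -(mulrA (u * z)).
rewrite (IH p.+1 q) ?(IH p q.+1) ?subrr //.
- by rewrite expvSr memv_mul.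
- by rewrite addnS -!addSn.
- by rewrite expvSl memv_mul.
- by rewrite addnS addSn -!addSn.
Qed.

Lemma ad_word_closed g s z : comm_closed g -> {subset s <= g} -> z \in g ->
  ad_word s z \in g.
Proof.
move=> cg; elim: s => //= a s IH sg zg; apply: cg; first by apply: sg; rewrite inE eqxx.
by apply: IH => // b sb; apply: sg; rewrite inE sb orbT.
Qed.

(** A subalgebra [k] of [g] of largest dimension among the associatively
    nilpotent ones is [g] itself: as [ad k] is nilpotent, some [y] in [g] outside
    [k] would normalise [k], and [k + <[y]>] would be a larger one. *)
Lemma engel g : comm_closed g -> {in g, forall x, exists m, x ^+ m = 0} ->
  exists n, (g ^+ n = 0)%VS.
Proof.
move=> cg nil_g.
pose P d := `[< exists k, [/\ (k <= g)%VS, comm_closed k,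
                              exists n, (k ^+ n.+1 = 0)%VS & \dim k = d] >].
have exP : exists d, P d.
  exists 0%N; apply/asboolP; exists 0%VS; split; rewrite ?sub0v ?dimv0 //.
    by move=> x y /[!memv0] /eqP-> /eqP->; rewrite mul0r subrr.
  by exists 0%N; rewrite expv1.
have ubP d : P d -> (d <= \dim {:A})%N.
  by move=> /asboolP[k [_ _ _ <-]]; rewrite dimvS ?subvf.
case: (ex_maxnP exP ubP) => d /asboolP[k [kg ck [n kn] dk]] maxd.
have [gk|/subvPn[z zg zk]] := boolP (g <= k)%VS.
  exists n.+1; apply/eqP; rewrite -subv0 -kn; exact: expvS.
(* an element of [g] outside [k] that normalises [k], taken among the longest
   nonzero brackets modulo [k] *)
have [y [yg yk nky]] : exists y, [/\ y \in g, y \notin k &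
    forall a, a \in k -> a * y - y * a \in k].
  pose R m := `[< forall s, {subset s <= k} -> size s = m -> ad_word s z \in k >].
  have exR : exists m, R m.
    exists (n.+1 + n.+1)%N; apply/asboolP => s sk ss.
    by rewrite (ad_word_nilp _ kn sk) ?mem0v // ss.
  case: (ex_minnP exR) => -[|m] /asboolP Rm minm.
    by have := Rm [::] (fun _ => ltac:(done)) erefl; rewrite (negbTE zk).
  have /asboolPn : ~~ R m by apply/negP => /minm; rewrite ltnn.
  move=> /existsNP[s /not_implyP[sk /not_implyP[ss /negP sz]]].
  exists (ad_word s z); split=> // [|a ka].
    by apply: ad_word_closed => // a /sk; apply: (subvP kg).
  apply: (Rm (a :: s)); last by rewrite /= ss.
  by move=> b; rewrite inE => /predU1P[->|/sk].
have [m ym] := nil_g _ yg.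
have : (\dim (k + <[y]>) <= d)%N.
  apply: maxd; apply/asboolP; exists (k + <[y]>)%VS; split=> //.
  - by rewrite subv_add kg -memvE.
  - move=> _ _ /memv_addP[u ku [_ /vlineP[c ->] ->]]
      /memv_addP[v kv [_ /vlineP[e ->] ->]].
    have -> : (u + c *: y) * (v + e *: y) - (v + e *: y) * (u + c *: y) =
       (u * v - v * u) + e *: (u * y - y * u) - c *: (v * y - y * v).
      rewrite !(mulrDl, mulrDr) -!scalerAl -!scalerAr !scalerA (mulrC e c) !scalerBr.
      rewrite !opprD !opprK !addrA [LHS](ACl (1*5*2*7*6*3*(4*8)))/=.
      by rewrite subrr addr0.
    apply: (subvP (addvSl _ _)).
    by apply: rpredB; [apply: rpredD|]; rewrite ?rpredZ ?nky ?ck.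
  - case: (posnP m) => [m0|m_gt0].
      exists 0%N; apply/eqP; rewrite expv1 -subv0; apply/subvP => x _.
      by rewrite -[x]mulr1 -(expr0 y) -m0 ym mulr0 mem0v.
    exists (m * n.+1).-1; rewrite prednK ?muln_gt0 ?m_gt0 //.
    exact: expv_adjoin_nilp.
rewrite leqNgt => /negP[]; rewrite -dk ltn_neqAle dimvS ?addvSl // andbT.
apply: contra yk => /eqP dE.
have /eqP-> : (k == k + <[y]>)%VS by rewrite eqEdim addvSl dE leqnn.
by rewrite memvE addvSr.
Qed.
End Engel.

(** * Splitting fields, Chinese remainders, rationals in characteristic 0 *)

Lemma ex_irreducible_dvdp (F : fieldType) (p : {poly F}) : (1 < size p)%N ->
  exists2 r, r %| p & irreducible_poly r.
Proof.
move: {2}(size p).+1 (ltnSn (size p)) => n; elim: n p => // n IH p sp p1.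
have [irr|/not_andP[//|]] := pselect (irreducible_poly p); first by exists p.
move=> /existsNP[q /not_implyP[q1 /not_implyP[qp /negP nqp]]].
have p0 : p != 0 by rewrite -size_poly_gt0 ltnW.
have sq : (size q < size p)%N.
  by rewrite ltn_neqAle dvdp_leq // andbT dvdp_size_eqp.
have q0 : q != 0 by apply: contraNneq p0 => q0; rewrite q0 dvd0p in qp.
have [||r rq irr] := IH q; last by exists r => //; apply: dvdp_trans qp.
- exact: leq_trans sq _.
- by rewrite ltn_neqAle eq_sym q1 size_poly_gt0.
Qed.

(** The splitting field is built by adjoining one root at a time; it is only
    obtained as a field with a morphism, which is all that a base change needs. *)
Lemma ex_splitting (F : fieldType) (p : {poly F}) : p != 0 ->
  exists (E : fieldType) (iota : {rmorphism F -> E}) (zs : seq E),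
    map_poly iota p %= \prod_(z <- zs) ('X - z%:P).
Proof.
move: {2}(size p).+1 (ltnSn (size p)) => n; elim: n F p => // n IH F p sp p0.
have [p1|p1] := leqP (size p) 1.
  exists F, idfun, [::]; rewrite big_nil map_poly_id //.
  by rewrite -size_poly_eq1 eqn_leq p1 size_poly_gt0.
have [r rp irr] := ex_irreducible_dvdp p1.
have [E _ [x rx _]] := irredp_FAdjoin irr.
have : root (map_poly (in_alg E) p) x.
  by rewrite -(divpK rp) rmorphM rootM rx orbT.
move=> /factor_theorem[q Dp].
have Dsp : size p = size (q * ('X - x%:P)) by rewrite -Dp size_map_poly.
have q0 : q != 0.
  by apply: contraNneq p0 => q0; rewrite -size_poly_eq0 Dsp q0 mul0r size_poly0.
have [|L [iota [zs Dq]]] := IH E q _ q0.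
  by move: sp; rewrite Dsp size_mul ?polyXsubC_eq0 // size_XsubC addn2.
exists L, (iota \o in_alg E), (iota x :: zs).
rewrite map_poly_comp Dp rmorphM /= rmorphB /= map_polyX map_polyC /= big_cons mulrC.
exact: eqp_mull.
Qed.

Section CRT.
Variable E : fieldType.
Implicit Types (s : seq E) (nu mu : E).

Lemma coprimep_prod_Xsub nu s N : nu \notin s ->
  coprimep (\prod_(mu <- s) ('X - mu%:P) ^+ N) (('X - nu%:P) ^+ N).
Proof.
elim: s => [|mu s IH]; first by rewrite big_nil coprime1p.
rewrite inE big_cons => /norP[ne nus]; rewrite coprimepMl IH // andbT.
by apply: coprimep_expl; apply: coprimep_expr; apply: coprimep_XsubC2; rewrite subr_eq0.
Qed.

(** Chinese remaindering: a prescribed constant at each point, to order [N]. *)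
Lemma crt_Xsub s (phi : E -> E) N : uniq s ->
  exists Q, {in s, forall nu, ('X - nu%:P) ^+ N %| Q - (phi nu)%:P}.
Proof.
elim: s => [|nu s IH] /=; first by exists 0.
move=> /andP[nus /IH[Q HQ]].
set M := \prod_(mu <- s) ('X - mu%:P) ^+ N.
have /Bezout_eq1_coprimepP[[u v] /= uv] := coprimep_prod_Xsub N nus.
exists (Q + ((phi nu)%:P - Q) * (u * M)) => mu; rewrite inE => /predU1P[->|mus].
  rewrite (_ : _ - _ = ((phi nu)%:P - Q) * (u * M - 1)); last first.
    by rewrite mulrBr mulr1 opprB [RHS]addrCA addrA.
  by rewrite -uv opprD addNKr dvdp_mull // -mulNr dvdp_mull.
rewrite addrAC dvdp_add ?HQ // !dvdp_mull // /M (big_rem mu) //=.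
exact: dvdp_mulr.
Qed.

Lemma dvdp_prod_Xsub s N Q : uniq s ->
  {in s, forall nu, ('X - nu%:P) ^+ N %| Q} ->
  \prod_(mu <- s) ('X - mu%:P) ^+ N %| Q.
Proof.
elim: s => [|nu s IH] /=; first by rewrite big_nil dvd1p.
move=> /andP[nus us] H; rewrite big_cons Gauss_dvdp; last first.
  by rewrite coprimep_sym coprimep_prod_Xsub.
rewrite H ?mem_head // IH // => mu mus; apply: H; by rewrite inE mus orbT.
Qed.
End CRT.

(** [ratr] is additive and multiplicative for every field of characteristic 0,
    ordered or not: splitting fields carry no order. *)
Section RatrChar0.
Variables (E : fieldType) (E0 : [pchar E] =i pred0).

Lemma intr_neq0_pchar0 (k : int) : k != 0 -> k%:~R != 0 :> E.
Proof.
have /pcharf0P H := E0; move=> k0.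
have := H `|k|%N; rewrite absz_eq0 (negbTE k0) => /negbT.
by case: k {k0} => k; rewrite ?NegzE ?rmorphN ?oppr_eq0.
Qed.

Lemma ratr_frac (x : rat) (n d : int) :
  d != 0 -> x * d%:~R = n%:~R -> ratr x = n%:~R / d%:~R :> E.
Proof.
move=> d0 xd; rewrite /ratr; apply/eqP.
rewrite eqr_div ?intr_neq0_pchar0 ?denq_neq0 // -!rmorphM /=; apply/eqP; congr _%:~R.
by apply: (@intr_inj rat); rewrite !rmorphM /= numqE -xd; ring.
Qed.

Lemma ratr_linear_pchar0 (a x y : rat) :
  ratr (a * x + y) = ratr a * ratr x + ratr y :> E.
Proof.
have nz z : (denq z)%:~R != 0 :> E by rewrite intr_neq0_pchar0 ?denq_neq0.
rewrite (@ratr_frac _ (numq a * numq x * denq y + numq y * (denq a * denq x))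
  (denq a * denq x * denq y)); last 2 first.
- by rewrite !mulf_neq0 ?denq_neq0.
- by rewrite !(rmorphD, rmorphM) /= !numqE; ring.
by rewrite /ratr !(rmorphD, rmorphM) /=; field; rewrite !nz.
Qed.
End RatrChar0.

(** * Traces of nilpotent and idempotent matrices; spectral projections *)

Section Traces.
Variable F : fieldType.

(** Writing [X = C * R] with inner dimension [\rank X], the matrix [R * C] is
    smaller, nilpotent, and has the same trace. *)
Lemma mxtrace_nilp n (X : 'M[F]_n) m : X ^+ m = 0 -> \tr X = 0.
Proof.
elim/ltn_ind: n X m => n IH X m Xm.
have [le_rn|lt_rn] := leqP n (\rank X).
  have uX : X \in unitmx by rewrite -row_full_unit /row_full eqn_leq rank_leq_col.
  suff -> : X = 0 by rewrite mxtrace0.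
  have E k : X ^+ k * invmx X ^+ k = 1.
    elim: k => [|k IHk]; first by rewrite !expr0 mulr1.
    rewrite exprSr exprS mulrA -(mulrA (X ^+ k)).
    by rewrite [X * invmx X]mulmxV // mulr1.
  by rewrite -[X]mulr1 -(E m) Xm mul0r mulr0.
rewrite -{1}(mulmx_base X) mxtrace_mulC; apply: (IH _ lt_rn _ m.+1).
have E k : (row_base X *m col_base X) ^+ k.+1 = row_base X *m X ^+ k *m col_base X.
  elim: k => [|k IHk]; first by rewrite expr1 expr0 mulmx1.
  rewrite exprS IHk exprS.
  have -> : X * X ^+ k = col_base X *m row_base X *m X ^+ k by rewrite mulmx_base.
  by rewrite -mulmxE !mulmxA.
by rewrite E Xm mulmx0 mul0mx.
Qed.

(** For a rank factorisation [P = U * V], idempotency says that [V * U] is the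
    identity matrix of size [\rank P]. *)
Lemma mxtrace_idem n (P : 'M[F]_n) : P *m P = P -> \tr P = (\rank P)%:R.
Proof.
move=> PP; rewrite -{1}(mulmx_base P) mxtrace_mulC.
suff -> : row_base P *m col_base P = 1%:M by rewrite mxtrace1.
have /row_freeP[R RR] := row_base_free P.
have /row_fullP[C CC] := col_base_full P.
move: (row_base P) (col_base P) (mulmx_base P) RR CC => V U DP RR CC.
transitivity (C *m ((U *m V) *m (U *m V)) *m R).
  by rewrite !mulmxA CC mul1mx -mulmxA RR mulmx1.
have -> : (U *m V) *m (U *m V) = U *m V by rewrite DP PP.
by rewrite mulmxA CC mul1mx RR.
Qed.
End Traces.

(** A matrix of largest rank among those with all rows in the subspace spans it. *)
Lemma mx_of_submod (F : fieldType) m (P : 'rV[F]_m -> Prop) :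
  P 0 -> (forall a u v, P u -> P v -> P (a *: u + v)) ->
  exists R : 'M[F]_m, forall c : 'rV_m, (c <= R)%MS <-> P c.
Proof.
move=> P0 PD.
pose D d := `[< exists R : 'M[F]_m, (forall c : 'rV_m, (c <= R)%MS -> P c) /\ \rank R = d >].
have exD : exists d, D d.
  exists 0%N; apply/asboolP; exists 0; split; last by rewrite mxrank0.
  by move=> c /[!submx0] /eqP->.
have ubD d : D d -> (d <= m)%N by move=> /asboolP[R [_ <-]]; apply: rank_leq_row.
case: (ex_maxnP exD ubD) => d /asboolP[R [RP <-]] maxd; exists R => c; split; first exact: RP.
move=> Pc; apply: submx_trans (addsmxSr R c) _.
have := mxrank_leqif_sup (addsmxSl R c); case=> le <-.
rewrite eqn_leq le /=; apply: maxd; apply/asboolP; exists (R + c)%MS; split=> // u.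
move=> /sub_addsmxP[[A B] /= ->]; rewrite addrC [B]mx11_scalar mul_scalar_mx.
by apply: PD => //; apply: RP; apply: submxMl.
Qed.

Section Spectral.
Variables (E : fieldType) (n m N : nat).
Implicit Types (X A B : 'M[E]_n.+1).
Variables (X : 'M[E]_n.+1) (mu : 'I_m -> E).
Hypothesis mu_inj : injective mu.
Hypothesis X0 : horner_mx X (\prod_(i < m) ('X - (mu i)%:P) ^+ N) = 0.

(** The projections on the generalised eigenspaces of [X] are polynomials in [X]:
    the [i]-th is congruent to 1 modulo [('X - mu_i) ^ N] and to 0
    modulo the others. *)
Lemma spectral_idempotents : exists Pi : 'I_m -> 'M[E]_n.+1,
  [/\ \sum_i Pi i = 1,
      forall i j, Pi i * Pi j = (i == j)%:R *: Pi i,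
      forall i, GRing.comm X (Pi i) &
      forall i, (X - (mu i)%:M) ^+ N * Pi i = 0].
Proof.
have us : uniq (codom mu) by rewrite map_inj_uniq ?enum_uniq.
have killP (Q : {poly E}) :
    (forall i, ('X - (mu i)%:P) ^+ N %| Q) -> horner_mx X Q = 0.
  move=> H; have /dvdpP[C ->] : \prod_(i < m) ('X - (mu i)%:P) ^+ N %| Q.
    rewrite -(big_image _ _ _ _ (fun z => ('X - z%:P) ^+ N)) /=.
    by apply: dvdp_prod_Xsub => // _ /codomP[i ->].
  by rewrite rmorphM /= X0 mulr0.
have [p Hp] : exists p : 'I_m -> {poly E}, forall i k,
    ('X - (mu k)%:P) ^+ N %| p i - ((i == k)%:R)%:P.
  suff /choice[p Hp] : forall i, exists Q : {poly E}, forall k,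
    ('X - (mu k)%:P) ^+ N %| Q - ((i == k)%:R)%:P by exists p.
  move=> i; have [Q HQ] := crt_Xsub (fun z => (mu i == z)%:R) N us.
  exists Q => k; have := HQ _ (codom_f mu k); by rewrite (inj_eq mu_inj).
exists (fun i => horner_mx X (p i)); split.
- rewrite -rmorph_sum /=; apply/eqP; rewrite -subr_eq0 -(rmorph1 (horner_mx X)) -rmorphB /=.
  apply/eqP/killP => k.
  rewrite (_ : \sum_i p i - 1 = \sum_i (p i - ((i == k)%:R)%:P)).
    apply: (big_ind (fun q => ('X - (mu k)%:P) ^+ N %| q)) => //; exact: dvdp_add.
  rewrite sumrB; congr (_ - _); rewrite (bigD1 k) //= eqxx big1 ?addr0 //.
  by move=> i /negbTE->.
- move=> i j; rewrite -rmorphM /= -horner_mxZ; apply/eqP; rewrite -subr_eq0 -rmorphB /=.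
  apply/eqP/killP => k.
  rewrite (_ : p i * p j - _ = p i * (p j - ((j == k)%:R)%:P) +
       ((j == k)%:R - (i == j)%:R) *: (p i - ((i == k)%:R)%:P)).
    by rewrite dvdp_add ?dvdp_mull // -mul_polyC dvdp_mull.
  have bc : ((j == k)%:R - (i == j)%:R) * (i == k)%:R = 0 :> E.
    by have [->|] := eqVneq i k; rewrite ?(eq_sym k) ?subrr ?mul0r ?mulr0.
  rewrite -!mul_polyC [in RHS](mulrBr (_ - _)%:P) -polyCM bc subr0 polyCB.
  by move: (_%:P) (_%:P) => u v; ring.
- by move=> i; apply: comm_mx_horner.
- move=> i; rewrite (_ : X - _ = horner_mx X ('X - (mu i)%:P)); last first.
    by rewrite rmorphB /= horner_mx_X horner_mx_C.
  rewrite -rmorphXn -rmorphM /=; apply: killP => k.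
  have [->|ne] := eqVneq i k; first exact: dvdp_mulr.
  by have := Hp i k; rewrite (negbTE ne) subr0 => /dvdp_mull->.
Qed.
End Spectral.

(** * Nilpotency from vanishing traces *)

(** Left multiplication by [a] and right multiplication by [b] commute, so
    this is the nilpotency of a difference of commuting nilpotent operators. *)
Lemma iter_ad_nilp (R : nzRingType) (a b z : R) p q r :
  a ^+ p * z = 0 -> z * b ^+ q = 0 -> (p + q <= r.+1)%N ->
  iter r (fun t => a * t - t * b) z = 0.
Proof.
pose ad t := a * t - t * b; rewrite -/ad.
have ad0 k : iter k ad 0 = 0 by elim: k => //= k ->; rewrite /ad mulr0 mul0r subrr.
have adB k s t : iter k ad (s - t) = iter k ad s - iter k ad t.
  elim: k => //= k ->; rewrite /ad mulrBr mulrBl !opprB !addrA.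
  by rewrite [LHS](ACl (1*4*3*2)).
elim: r p q z => [|r IH] [|p] [|q] z; rewrite ?expr0 ?mul1r ?mulr1;
  try by [move=> -> *; exact: ad0 | move=> _ -> *; exact: ad0].
  by rewrite addSn addnS.
rewrite iterSr adB => pz zq pq.
rewrite (IH p q.+1) ?(IH p.+1 q) ?subrr //.
- by rewrite mulrA pz mul0r.
- by rewrite -mulrA -exprS.
- by rewrite addSn -addnS.
- by rewrite mulrA -exprSr.
- by rewrite -mulrA zq mulr0.
Qed.

Section AdPoly.
Import FalgLfun.
Variables (E : fieldType) (A : falgType E).
Implicit Types (f : 'End(A)) (x y z : A).

Lemma lfun_expE f k z : (f ^+ k) z = iter k f z.
Proof. by elim: k => [|k IH]; rewrite ?expr0 ?id_lfunE // exprSr lfun_mulE IH. Qed.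

Definition lfun_ad x : 'End(A) := amull x - amulr x.
Lemma lfun_adE x z : lfun_ad x z = x * z - z * x.
Proof. by rewrite add_lfunE opp_lfunE !lfunE. Qed.

(** On the block from the generalised eigenspace of [b] to that of [a], [ad x]
    has the single eigenvalue [a - b], to order at most [2 N - 1]; the value of [Q] there
    is therefore the constant to which [Q] is congruent. *)
Lemma horner_ad_block x (Q : {poly E}) (a b c : E) N z :
  ('X - (a - b)%:P) ^+ (N + N) %| Q - c%:P ->
  (x - a%:A) ^+ N * z = 0 -> z * (x - b%:A) ^+ N = 0 ->
  horner_alg (lfun_ad x) Q z = c *: z.
Proof.
move=> /dvdpP[D DQ] xz zx.
have -> : Q = c%:P + ('X - (a - b)%:P) ^+ (N + N) * D.
  by rewrite mulrC -DQ addrC subrK.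
rewrite rmorphD rmorphM rmorphXn rmorphB /= !horner_algC horner_algX add_lfunE.
rewrite scale_lfunE id_lfunE lfun_mulE lfun_expE.
rewrite (eq_iter (f' := fun t => (x - a%:A) * t - t * (x - b%:A))).
  by rewrite (iter_ad_nilp xz zx) ?leqnSn // linear0 addr0.
move=> t; rewrite add_lfunE lfun_adE opp_lfunE scale_lfunE id_lfunE /=.
rewrite mulrBl mulrBr -scalerAl -scalerAr mul1r mulr1 scalerBl.
by rewrite !opprB !addrA [RHS](ACl (1*4*3*2)).
Qed.

Lemma scalar_horner_ad (T : {scalar A}) x (Q : {poly E}) z :
  (forall k, T (iter k (fun t => x * t - t * x) z) = 0) ->
  T (horner_alg (lfun_ad x) Q z) = 0.
Proof.
elim/poly_ind: Q z => [|Q c IH] z H; first by rewrite rmorph0 zero_lfunE linear0.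
rewrite rmorphD rmorphM /= horner_algX horner_algC add_lfunE addrC scale_lfunE id_lfunE.
rewrite linearP (H 0%N) mulr0 add0r.
have -> : horner_alg (lfun_ad x) Q * lfun_ad x = lfun_ad x * horner_alg (lfun_ad x) Q.
  transitivity (horner_alg (lfun_ad x) ('X * Q)).
    by rewrite mulrC rmorphM /= horner_algX.
  by rewrite rmorphM /= horner_algX.
by rewrite lfun_mulE IH // => k; rewrite lfun_adE -iterSr H.
Qed.
End AdPoly.

Section SpectralTrace.
Import FalgLfun.
Variables (E : fieldType) (E0 : [pchar E] =i pred0) (n m N : nat).
Variables (X : 'M[E]_n.+1) (mu : 'I_m -> E) (Pi : 'I_m -> 'M[E]_n.+1).
Hypotheses (mu_inj : injective mu) (sumPi : \sum_i Pi i = 1).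
Hypothesis mulPi : forall i j, Pi i * Pi j = (i == j)%:R *: Pi i.
Hypothesis commPi : forall i, GRing.comm X (Pi i).
Hypothesis nilPi : forall i, (X - (mu i)%:M) ^+ N * Pi i = 0.

(** The operator acting as the rational number [w i] on the [i]-th generalised
    eigenspace of [X]. *)
Definition spectral_map (w : 'I_m -> rat) : 'M[E]_n.+1 :=
  \sum_i ratr (w i) *: Pi i.

Lemma mulPi_map i w : Pi i * spectral_map w = ratr (w i) *: Pi i.
Proof.
rewrite mulr_sumr (bigD1 i) //= -scalerAr mulPi eqxx scale1r big1 ?addr0 // => j ji.
by rewrite -scalerAr mulPi eq_sym (negbTE ji) scale0r scaler0.
Qed.

Lemma mul_mapPi i w : spectral_map w * Pi i = ratr (w i) *: Pi i.
Proof.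
rewrite mulr_suml (bigD1 i) //= -scalerAl mulPi eqxx scale1r big1 ?addr0 // => j ji.
by rewrite -scalerAl mulPi (negbTE ji) scale0r scaler0.
Qed.

(** On the block [(i, j)] the bracket with the spectral map is [w i - w j], and
    the hypothesis makes this a function [phi] of the eigenvalue [mu i - mu j] of
    [ad X]; [Q] interpolates [phi]. *)
Lemma ad_spectral_map w :
  (forall i j k l, mu i - mu j = mu k - mu l -> w i - w j = w k - w l) ->
  exists Q, forall B, spectral_map w * B - B * spectral_map w =
                      horner_alg (lfun_ad X) Q B.
Proof.
move=> Hw; pose phi (z : E) : E :=
  if [pick p : 'I_m * 'I_m | mu p.1 - mu p.2 == z] is Some p
  then ratr (w p.1 - w p.2) else 0.
have phiE i j : phi (mu i - mu j) = ratr (w i - w j).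
  rewrite /phi; case: pickP => [[k l] /= /eqP/Hw-> //|/(_ (i, j))/=].
  by rewrite eqxx.
pose s := undup [seq mu p.1 - mu p.2 | p : 'I_m * 'I_m].
have [Q HQ] := crt_Xsub phi (N + N) (undup_uniq _ : uniq s).
exists Q => B.
have -> : B = \sum_i \sum_j Pi i * B * Pi j.
  under eq_bigr do rewrite -mulr_sumr sumPi mulr1.
  by rewrite -mulr_suml sumPi mul1r.
rewrite mulr_sumr mulr_suml -sumrB linear_sum; apply: eq_bigr => i _.
rewrite mulr_sumr mulr_suml -sumrB linear_sum; apply: eq_bigr => j _.
rewrite !mulrA mul_mapPi -(mulrA (_ * B)) mulPi_map.
rewrite -!scalerAl -scalerAr -scalerBl.
have -> : ratr (w i) - ratr (w j) = phi (mu i - mu j).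
  rewrite phiE -[w i - w j]addrC -[- w j]mulN1r (ratr_linear_pchar0 E0) addrC.
  by rewrite -[ratr (-1)]/(ratr (-1)%:~R) ratr_int mulN1r.
have nilPi' k : (X - (mu k)%:A) ^+ N * Pi k = 0 by rewrite [_%:A]scalemx1.
apply/esym/(@horner_ad_block _ _ _ _ (mu i) (mu j) _ N).
- apply: HQ; rewrite mem_undup; apply/mapP; exists (i, j); rewrite ?mem_enum //.
- by rewrite !mulrA nilPi' !mul0r.
- suff -> : Pi i * B * Pi j * (X - (mu j)%:A) ^+ N =
    Pi i * B * ((X - (mu j)%:A) ^+ N * Pi j) by rewrite nilPi' mulr0.
  rewrite -mulrA; congr (_ * _); apply: commrX; apply: commrB.
    exact: commr_sym.
  by rewrite /GRing.comm -scalerAl -scalerAr mulr1 mul1r.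
Qed.

(** On the image of [Pi i], [X] is [mu i] plus a nilpotent map, so it has trace
    [mu i] times the dimension of that image. *)
Lemma trace_spectral_map w :
  \tr (X * spectral_map w) = \sum_i ratr (w i) * (mu i * (\rank (Pi i))%:R).
Proof.
rewrite mulr_sumr raddf_sum; apply: eq_bigr => i _ /=.
rewrite -scalerAr mxtraceZ; congr (_ * _).
have -> : X * Pi i = (X - (mu i)%:M) * Pi i + mu i *: Pi i.
  by rewrite mulrBl -[(mu i)%:M * _]/(_ *m _) mul_scalar_mx subrK.
have PiPi : Pi i * Pi i = Pi i by rewrite mulPi eqxx scale1r.
rewrite mxtraceD mxtraceZ (mxtrace_idem PiPi) (@mxtrace_nilp _ _ _ N.+1) ?add0r //.
have cP : GRing.comm (X - (mu i)%:M) (Pi i).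
  apply/commr_sym/commrB; first exact: commr_sym.
  exact: comm_mx_scalar.
by rewrite exprMn_comm // exprS [Pi i ^+ _]exprS mulrA -(mulrA _ _ (Pi i)) nilPi mulr0 mul0r.
Qed.

Let relval (c : 'rV[rat]_m) : E := \sum_i ratr (c 0 i) * mu i.

Let relval_linear a u v : relval (a *: u + v) = ratr a * relval u + relval v.
Proof.
rewrite /relval mulr_sumr -big_split; apply: eq_bigr => i _ /=.
by rewrite !mxE ratr_linear_pchar0 // mulrDl mulrA.
Qed.

Let relval_delta i : relval (delta_mx 0 i) = mu i.
Proof.
rewrite /relval (bigD1 i) //= mxE !eqxx (ratr_nat E 1) mul1r big1 ?addr0 // => j ji.
by rewrite mxE (negbTE ji) andbF (ratr_nat E 0) mul0r.
Qed.

Let relvalB u v : relval (u - v) = relval u - relval v.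
Proof.
by rewrite addrC -scaleN1r relval_linear -[ratr (-1)]/(ratr (-1)%:~R) ratr_int mulN1r addrC.
Qed.

(** The hypothesis is used for the columns [w] of a matrix whose columns cut out
    the space of rational relations between the [mu i]. Each of these is
    orthogonal to every relation, so the compatibility condition holds; the
    vanishing trace says that [w i * \rank (Pi i)] is a relation as well, and its
    product with [w] is a sum of squares. *)
Lemma nilpotent_of_traces :
  (forall w, (forall i j k l, mu i - mu j = mu k - mu l -> w i - w j = w k - w l) ->
     \tr (X * spectral_map w) = 0) ->
  X ^+ N = 0.
Proof.
move=> H.
have [||R HR] := @mx_of_submod _ m (fun c => relval c = 0).
- by rewrite /relval big1 // => i _; rewrite mxE (ratr_nat E 0) mul0r.
- by move=> a u v Pu Pv; rewrite relval_linear Pu Pv mulr0 addr0.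
have [C HC] : exists C : 'M[rat]_m, forall c : 'rV_m, (c <= R)%MS = (c *m C == 0).
  by exists (cokermx R) => c; apply: submxE.
suff mu0 i : Pi i != 0 -> mu i = 0.
  rewrite -[LHS]mulr1 -sumPi mulr_sumr big1 // => i _.
  have [->|/mu0 mui] := eqVneq (Pi i) 0; first by rewrite mulr0.
  by have := nilPi i; rewrite mui raddf0 subr0.
move=> Pi0.
suff : ((delta_mx 0 i : 'rV[rat]_m) <= R)%MS by move/HR; rewrite relval_delta.
rewrite HC; apply/eqP/rowP => k; rewrite [RHS]mxE -rowE mxE.
(* the columns of [C] span the orthogonal of the space of relations *)
pose w j := C j k.
have perp (c : 'rV[rat]_m) : relval c = 0 -> (c *m C) 0 k = 0.
  by move=> /HR; rewrite HC => /eqP->; rewrite mxE.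
have Hw i1 j1 k1 l1 : mu i1 - mu j1 = mu k1 - mu l1 -> w i1 - w j1 = w k1 - w l1.
  move=> e; have := perp (delta_mx 0 i1 - delta_mx 0 j1 - (delta_mx 0 k1 - delta_mx 0 l1)).
  rewrite !relvalB !relval_delta e subrr => /(_ erefl).
  by rewrite !mulmxBl -!rowE !mxE => /eqP; rewrite subr_eq0 => /eqP.
have tr0 := H _ Hw; rewrite trace_spectral_map in tr0.
have := perp (\row_j (w j * (\rank (Pi j))%:R)).
have -> : relval (\row_j (w j * (\rank (Pi j))%:R)) = 0.
  rewrite -tr0; apply: eq_bigr => j _; rewrite mxE.
  have := ratr_linear_pchar0 E0 (w j) (\rank (Pi j))%:R 0.
  rewrite !addr0 (ratr_nat E 0) addr0 ratr_nat => ->.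
  by rewrite -mulrA; congr (_ * _); rewrite mulrC.
move=> /(_ erefl); rewrite mxE => H0.
have : (\row_j (w j * (\rank (Pi j))%:R)) 0 i * w i = 0.
  apply: (psumr_eq0P _ H0) => // j _; rewrite mxE mulrAC mulr_ge0 ?ler0n //.
  exact: sqr_ge0.
move=> /eqP; rewrite mxE !mulf_eq0 pnatr_eq0 mxrank_eq0 (negbTE Pi0) orbF.
by case/orP => /eqP.
Qed.
End SpectralTrace.

(** * Cartan's criterion *)

Lemma dvdp_prod_undup (E : fieldType) (zs : seq E) :
  \prod_(z <- zs) ('X - z%:P) %| \prod_(z <- undup zs) ('X - z%:P) ^+ size zs.
Proof.
rewrite prodrXl; set P := \prod_(z <- undup zs) _.
have H : {in zs, forall z, 'X - z%:P %| P}.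
  by move=> z; rewrite -mem_undup => zz; rewrite /P (big_rem z) //= dvdp_mulr.
have {}H : all (fun z => 'X - z%:P %| P) zs by apply/allP.
move: P H => P; elim: zs => [|z zs IH] /=; first by rewrite big_nil dvd1p.
by move=> /andP[zP /IH zsP]; rewrite big_cons exprS dvdp_mul.
Qed.

Section Cartan.
Import FalgLfun.
Variables (K : fieldType) (K0 : [pchar K] =i pred0) (n : nat).
Implicit Types (g : {vspace 'M[K]_n.+1}) (x y : 'M[K]_n.+1).

Definition commutators g := [seq a * b - b * a | a <- vbasis g, b <- vbasis g].

(** For [x] in [[g, g]] one has [tr (x y) = 0] for every spectral map [y] of [x]:
    by [ad_spectral_map], [tr ([a, b] y)] is a combination of the traces of
    [a * (ad x) ^ k b], which are computed over [K], inside [g]. *)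
Lemma nilpotent_derived g x : comm_closed g ->
  {in g &, forall a b, \tr (a * b) = 0} -> x \in g -> x \in <<commutators g>>%VS ->
  exists m, x ^+ m = 0.
Proof.
move=> cg tg xg xc.
have [E [iota [zs Dzs]]] := ex_splitting (monic_neq0 (char_poly_monic x)).
have E0 : [pchar E] =i pred0.
  move=> p; rewrite -[RHS](K0 p) !inE.
  by congr (_ && _); rewrite -(rmorph_nat iota) fmorph_eq0.
set N := size zs; exists N.
pose X := map_mx iota x; pose mu (i : 'I_(size (undup zs))) := (undup zs)`_i.
have mu_inj : injective mu.
  move=> i j /eqP; rewrite nth_uniq ?undup_uniq // => /eqP; exact: val_inj.
have X0 : horner_mx X (\prod_i ('X - (mu i)%:P) ^+ N) = 0.
  have /dvdpP[C ->] : map_poly iota (char_poly x) %| \prod_i ('X - (mu i)%:P) ^+ N.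
    rewrite (eqp_dvdl _ Dzs) (_ : \prod_i _ = \prod_(z <- undup zs) ('X - z%:P) ^+ N).
      exact: dvdp_prod_undup.
    by rewrite (big_nth 0) big_mkord.
  by rewrite rmorphM /= -map_horner_mx Cayley_Hamilton map_mx0 mulr0.
have [Pi [sumPi mulPi commPi nilPi]] := spectral_idempotents mu_inj X0.
have : X ^+ N = 0.
  apply: (nilpotent_of_traces E0 sumPi mulPi commPi nilPi) => w Hw.
  have [Q HQ] := ad_spectral_map E0 sumPi mulPi commPi nilPi Hw.
  set Y := spectral_map Pi w in HQ *.
  have tr0 a b : a \in g -> b \in g -> \tr (map_mx iota (a * b - b * a) * Y) = 0.
    move=> ag bg; set A := map_mx iota a; set B := map_mx iota b.
    have -> : map_mx iota (a * b - b * a) = A * B - B * A.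
      by rewrite map_mxB !map_mxM.
    have -> : \tr ((A * B - B * A) * Y) = - \tr (A * (Y * B - B * Y)).
      rewrite mulrBl mulrBr !(raddfB (@mxtrace E n.+1)) /= opprB !mulrA.
      by congr (_ - _); rewrite -!mulmxE -mulmxA mxtrace_mulC.
    rewrite HQ; apply/eqP; rewrite oppr_eq0; apply/eqP.
    apply: (@scalar_horner_ad _ _ (mxtrace \o mulmx A)) => k /=.
    have -> : iter k (fun t => X * t - t * X) B =
              map_mx iota (iter k (fun t => x * t - t * x) b).
      by elim: k => //= k ->; rewrite map_mxB !map_mxM.
    rewrite -map_mxM trace_map_mx tg ?rmorph0 //.
    by elim: k => //= k IH; apply: cg.
  suff trc y : y \in <<commutators g>>%VS -> \tr (map_mx iota y * Y) = 0 by exact: trc.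
  move=> yc; have {}yc : y \in <<in_tuple (commutators g)>>%VS by [].
  rewrite (coord_span yc) raddf_sum mulr_suml raddf_sum big1 // => i _ /=.
  rewrite map_mxZ -scalerAl mxtraceZ; set c := _`_i.
  suff /allpairsP[[a b] /= [/vbasis_mem ag /vbasis_mem bg ->]] : c \in commutators g.
    by rewrite tr0 ?mulr0.
  exact: mem_nth.
rewrite /X -rmorphXn -(map_mx0 iota); exact: map_mx_inj.
Qed.

(** Cartan's criterion. Perfectness gives [g <= g * g], hence [g <= g ^ m] for
    all positive [m], and Engel's theorem makes some power of [g] zero. *)
Theorem perfect_trace0 g : comm_closed g ->
  {in g &, forall a b, \tr (a * b) = 0} -> (g <= <<commutators g>>)%VS -> g = 0%VS.
Proof.
move=> cg tg pg.
have [|m gm] := engel cg.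
  by move=> x xg; apply: (nilpotent_derived cg tg xg); apply: (subvP pg).
have gg : (g <= g * g)%VS.
  apply: subv_trans pg _.
  apply/span_subvP => _ /allpairsP[[a b] /= [/vbasis_mem ag /vbasis_mem bg ->]].
  by rewrite rpredB ?memv_mul.
have gX k : (g <= g ^+ k.+1)%VS.
  elim: k => [|k IH]; first by rewrite expv1.
  by rewrite expvSl; apply: subv_trans gg _; apply: prodvSr.
by apply/eqP; rewrite -subv0; apply: subv_trans (gX m) _; rewrite expvSl gm prodv0.
Qed.
End Cartan.

Section MatrixOfEnd.
Variables (K : fieldType) (V : vectType K) (d : nat) (b : d.-tuple V).
Hypothesis b_basis : basis_of {:V} b.

Definition mx_end (T : 'End(V)) : 'M[K]_d := \matrix_(i, j) coord b i (T b`_j).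

Lemma mx_end_is_linear : linear mx_end.
Proof. by move=> c S T; apply/matrixP => i j; rewrite !mxE add_lfunE scale_lfunE linearP. Qed.
HB.instance Definition _ := GRing.isLinear.Build K 'End(V) 'M[K]_d _ mx_end mx_end_is_linear.

(** The columns of the matrix are the images of the basis vectors, so that
    composition becomes the product in the same order. *)
Lemma mx_end_comp S T : mx_end (S \o T)%VF = mx_end S *m mx_end T.
Proof.
apply/matrixP => i j; rewrite !mxE comp_lfunE.
rewrite {1}(coord_basis b_basis (memvf (T b`_j))) !linear_sum.
by apply: eq_bigr => k _; rewrite !mxE !linearZ /= mulrC.
Qed.

Lemma mx_endE (T : 'End(V)) (j : 'I_d) : T b`_j = \sum_i mx_end T i j *: b`_i.
Proof.
rewrite {1}(coord_basis b_basis (memvf (T b`_j))).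
by apply: eq_bigr => i _; rewrite mxE.
Qed.

Lemma mx_end_inj : injective mx_end.
Proof.
move=> S T ST; apply/lfunP => v.
rewrite (coord_basis b_basis (memvf v)) !linear_sum; apply: eq_bigr => j _ /=.
by rewrite !linearZ /= !mx_endE ST.
Qed.
End MatrixOfEnd.

Section TraceEnd.
Variables (K : fieldType) (V : vectType K).
Implicit Types S T : 'End(V).

Let b := vbasis {:V}.
Let bb : basis_of {:V} b := vbasisP _.

Lemma trace_mx T : trace T = \tr (mx_end b T).
Proof. by apply: eq_bigr => i _; rewrite mxE. Qed.

Lemma trace_compC S T : trace (S \o T)%VF = trace (T \o S)%VF.
Proof. by rewrite !trace_mx !mx_end_comp // mxtrace_mulC. Qed.

Lemma trace_sqr0 T : (T \o T)%VF = 0 -> trace T = 0.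
Proof.
move=> TT; rewrite trace_mx; apply: (@mxtrace_nilp _ _ _ 2).
have -> : mx_end b T ^+ 2 = mx_end b T *m mx_end b T by [].
by rewrite -(mx_end_comp bb) TT linear0.
Qed.
End TraceEnd.

Lemma mem_commutators (K : fieldType) n (g : {vspace 'M[K]_n.+1}) :
  {in g &, forall x y, x * y - y * x \in <<commutators g>>%VS}.
Proof.
move=> x y xg yg; rewrite (coord_vbasis xg) (coord_vbasis yg).
rewrite mulr_suml mulr_sumr -sumrB rpred_sum // => i _.
rewrite mulr_sumr mulr_suml -sumrB rpred_sum // => j _.
rewrite -!scalerAl -!scalerAr !scalerA [X in _ - X *: _]mulrC -scalerBr rpredZ //.
by apply: memv_span; apply: allpairs_f; apply: mem_nth; rewrite size_tuple.
Qed.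

Section CartanLie.
Variables (K : fieldType) (K0 : [pchar K] =i pred0) (L : finLieAlgType K).
Variables (V : vectType K) (rho : {linear L -> 'End(V)}).
Hypothesis rho_lie : forall x y,
  rho (lie x y) = (rho x \o rho y)%VF - (rho y \o rho x)%VF.

(** The matrices of [rho x] for [x] in [D] form a perfect Lie algebra with zero
    trace form. The size of the matrices is made a variable because Cartan's criterion
    is about matrices of nonzero size. *)
Lemma cartan_perfect (D : {vspace L}) : lieV D D = D ->
  {in D &, forall x y, trace (rho x \o rho y)%VF = 0} ->
  {in D, forall x, rho x = 0}.
Proof.
move=> DD trD x Dx.
have : exists d (b : d.-tuple V), basis_of {:V} b /\
  {in D &, forall x y, \tr (mx_end b (rho x \o rho y)%VF) = 0}.
  exists (\dim {:V}), (vbasis {:V}); split; first exact: vbasisP.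
  by move=> y z Dy Dz; rewrite -trace_mx trD.
case=> -[|n] [b [bb trb]].
  by apply: (mx_end_inj bb); rewrite [LHS]flatmx0 [RHS]flatmx0.
pose phi := linfun (mx_end b \o rho).
have phiE y : phi y = mx_end b (rho y) by rewrite lfunE.
have phi_lie y z : phi (lie y z) = phi y * phi z - phi z * phi y.
  by rewrite !phiE rho_lie linearB /= !mx_end_comp.
have memD y z : y \in D -> z \in D -> lie y z \in D.
  by move=> Dy Dz; rewrite -DD; apply: (lieV_sub _ _ _ (subvv _)).
have g0 : (phi @: D = 0)%VS.
  apply: (perfect_trace0 K0).
  - move=> _ _ /memv_imgP[y Dy ->] /memv_imgP[z Dz ->].
    by rewrite -phi_lie memv_img // memD.
  - move=> _ _ /memv_imgP[y Dy ->] /memv_imgP[z Dz ->].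
    by rewrite !phiE -mulmxE -mx_end_comp // trb.
  - rewrite -{1}DD limg_span; apply/span_subvP => _ /mapP[_ /allpairsP[[y z] /= [yD zD ->]] ->].
    by rewrite phi_lie mem_commutators // memv_img // vbasis_mem.
apply: (mx_end_inj bb); rewrite linear0 -phiE; apply/eqP.
by rewrite -memv0 -g0 memv_img.
Qed.
End CartanLie.

(** * The relative Killing form and the solvable radical *)

(** The quotient is realised on a complement of [M], together with
    a linear section of the projection. *)
Lemma ex_quotient (K : fieldType) (V : vectType K) (M : {vspace V}) :
  exists (Q : vectType K) (p : {linear V -> Q}) (s : {linear Q -> V}),
    cancel s p /\ forall x, (p x == 0) = (x \in M).
Proof.
pose U := (M^C)%VS.
exists (subvs_of U), (vsproj U \o daddv_pi U M), (@vsval _ _ U).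
have capUM : (U :&: M = 0)%VS by rewrite capvC capv_compl.
split=> [q|x] /=; first by rewrite daddv_pi_id ?subvsP // vsvalK.
have sumUM : (U + M)%VS = fullv by rewrite addvC addv_complf.
have xUM : x \in (U + M)%VS by rewrite sumUM memvf.
have <- := daddv_pi_add capUM xUM.
have pU : daddv_pi U M x \in U by apply: memv_pi.
have pM : daddv_pi M U x \in M by apply: memv_pi.
rewrite linearD /= (daddv_pi_id capUM pU).
have -> : daddv_pi U M (daddv_pi M U x) = 0.
  have MU0 : (M :&: U = 0)%VS by rewrite capvC.
  have := daddv_pi_add capUM (subvP (addvSr U M) _ pM).
  by rewrite (daddv_pi_id MU0 pM) -[X in _ = X]add0r => /addIr.
rewrite addr0 -(inj_eq (@subvs_inj _ _ U)) linear0 vsprojK //.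
rewrite rpredDr //; apply/eqP/idP => [->|pM']; first exact: mem0v.
by apply/eqP; rewrite -memv0 -capUM memv_cap pU.
Qed.

Section Derived.
Variables (K : fieldType) (L : finLieAlgType K).
Implicit Types I : {vspace L}.

Lemma ideal_lieV I : is_ideal I -> (lieV I I <= I)%VS.
Proof. by move=> iI; apply/lieV_sub => x y _; apply: iI. Qed.

Lemma derived_addn k l I : derived (k + l) I = derived k (derived l I).
Proof. exact: iterD. Qed.

Lemma derived_sub k I : is_ideal I -> (derived k.+1 I <= derived k I)%VS.
Proof. by move=> iI; rewrite -addn1 derived_addn; apply/derivedS/ideal_lieV. Qed.

Lemma derived_sub0 k I : is_ideal I -> (derived k I <= I)%VS.
Proof.
by move=> iI; elim: k => // k; apply: subv_trans; apply: derived_sub.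
Qed.

Lemma derived_stable I : is_ideal I -> exists k, derived k.+1 I = derived k I.
Proof.
move=> iI; pose P d := `[< exists k, \dim (derived k I) = d >].
have exP : exists d, P d by exists (\dim I); apply/asboolP; exists 0%N.
case: (ex_minnP exP) => d /asboolP[k dk] mind; exists k.
apply/eqP; rewrite eqEdim derived_sub //= dk; apply: mind.
by apply/asboolP; exists k.+1.
Qed.

(** By the Jacobi identity, [lie x] is a derivation. *)
Lemma lieV_ideal I : is_ideal I -> is_ideal (lieV I I).
Proof.
move=> iI x y /=; move: y.
suff H : (lieV I I <= linfun (lie x) @^-1: lieV I I)%VS.
  by move=> y /(subvP H); rewrite -memv_preim lfunE.
apply/lieV_sub => u v Iu Iv; rewrite -memv_preim lfunE /=.
have := lieJ x u v; rewrite -addrA => /eqP; rewrite addr_eq0 => /eqP->.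
have memI a b : a \in I -> b \in I -> lie a b \in lieV I I.
  exact: (lieV_sub _ _ _ (subvv _)).
rewrite rpredN rpredD //; apply: memI => //; last exact: iI.
by rewrite lieC rpredN iI.
Qed.

Lemma derived_ideal I k : is_ideal I -> is_ideal (derived k I).
Proof. by move=> iI; elim: k => //= k; apply: lieV_ideal. Qed.
End Derived.

Section KillingForm.
Variables (K : fieldType) (L : finLieAlgType K) (M : {vspace L}).
Hypothesis idM : is_ideal M.
Variables (Q : vectType K) (p : {linear L -> Q}) (s : {linear Q -> L}).
Hypotheses (sK : cancel s p) (kerp : forall x, (p x == 0) = (x \in M)).
Implicit Types (x y z : L) (N I R : {vspace L}).

Lemma quot_split z : exists2 m, m \in M & s (p z) = z + m.
Proof.
exists (s (p z) - z); last by rewrite addrC subrK.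
by rewrite -kerp linearB /= sK subrr.
Qed.

Lemma quot_ind (P : Q -> Prop) : (forall z, P (p z)) -> forall q, P q.
Proof. by move=> H q; rewrite -(sK q). Qed.

(** The adjoint action of [L] on [Q = L / M], computed on representatives. *)
Definition adq x : 'End(Q) := linfun (p \o lie x \o s).

Lemma adqE x z : adq x (p z) = p (lie x z).
Proof.
rewrite lfunE /=; have [m Mm ->] := quot_split z.
by rewrite linearDr linearD /=; have /eqP-> : p (lie x m) == 0; rewrite ?addr0 // kerp idM.
Qed.

Lemma adq_is_linear : linear adq.
Proof.
move=> c x y; apply/lfunP => q.
by rewrite add_lfunE scale_lfunE !lfunE /= linearPl linearP.
Qed.
HB.instance Definition _ := GRing.isLinear.Build K L 'End(Q) _ adq adq_is_linear.

Lemma adq_lie x y : adq (lie x y) = (adq x \o adq y)%VF - (adq y \o adq x)%VF.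
Proof.
apply/lfunP; apply: quot_ind => z.
rewrite add_lfunE opp_lfunE !comp_lfunE !adqE -linearB /=; congr (p _).
have := lieJ x y z; rewrite (lieC z (lie x y)) (lieC z x) linearNr /=.
by move/eqP; rewrite subr_eq0 => /eqP.
Qed.

(** The trace form of the adjoint representation on [L / M]; it is the Killing
    form of [L] when [M] is zero. *)
Definition killing x y : K^o := trace (adq x \o adq y)%VF.

Lemma killing_is_bilinear : bilinear_for *:%R *:%R killing.
Proof.
split=> [y c u v|x c u v]; rewrite /killing linearP.
  by rewrite comp_lfunDl -comp_lfunZl linearP.
by rewrite comp_lfunDr -comp_lfunZr linearP.
Qed.
HB.instance Definition _ := bilinear_isBilinear.Build K L L K^o _ _
  killing killing_is_bilinear.

Lemma killing_lie x y z : killing (lie x y) z = killing x (lie y z).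
Proof.
rewrite /killing !adq_lie !(comp_lfunDl, comp_lfunDr, comp_lfunNl, comp_lfunNr).
rewrite !linearB /= !comp_lfunA; congr (_ - _).
by rewrite -comp_lfunA trace_compC.
Qed.

(** The coordinates of the functional [killing x], so that the radical of the form is
    the kernel of a single linear map. *)
Definition killing_pairing x : 'rV[K]_(\dim {:L}) :=
  \row_j killing x (vbasis {:L})`_j.
Lemma killing_pairing_is_linear : linear killing_pairing.
Proof. by move=> c u v; apply/rowP => j; rewrite !mxE linearPl. Qed.
HB.instance Definition _ := GRing.isLinear.Build K L 'rV_(\dim {:L}) _
  killing_pairing killing_pairing_is_linear.

Definition killing_radical : {vspace L} := lker (linfun killing_pairing).

Lemma killing_radicalP x :
  reflect (forall y, killing x y = 0) (x \in killing_radical).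
Proof.
rewrite memv_ker lfunE; apply: (iffP eqP) => [/rowP H y|H]; last first.
  by apply/rowP => j; rewrite !mxE H.
rewrite (coord_vbasis (memvf y)) linear_sumr big1 // => j _.
by rewrite linearZr_LR /=; have := H j; rewrite !mxE => ->; rewrite scaler0.
Qed.

Lemma killing_radical_ideal : is_ideal killing_radical.
Proof.
move=> x y /killing_radicalP Ny; apply/killing_radicalP => z.
by rewrite lieC linearNl /= killing_lie Ny oppr0.
Qed.

Lemma ideal_sub_killing_radical : (M <= killing_radical)%VS.
Proof.
apply/subvP => x Mx; apply/killing_radicalP => y.
suff x0 : adq x = 0 by rewrite /killing x0 comp_lfun0l linear0.
apply/lfunP; apply: quot_ind => z; rewrite adqE zero_lfunE; apply/eqP.
by rewrite kerp lieC rpredN idM.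
Qed.

(** The derived series of the radical of the form becomes stationary at some [D]
    with [D = [D, D]]. By Cartan's criterion [D] acts by zero on [L / M], so that
    [D = [D, D]] is inside [M]. *)
Lemma killing_radical_solvable (K0 : [pchar K] =i pred0) :
  is_solvable M -> is_solvable killing_radical.
Proof.
move=> [m Mm]; have [k Dk] := derived_stable killing_radical_ideal.
set D := derived k killing_radical in Dk.
exists (m + k)%N; rewrite derived_addn -/D; apply/eqP; rewrite -subv0 -Mm.
apply: derivedS; rewrite -[D in (D <= _)%VS]Dk; apply/lieV_sub => x y Dx _.
rewrite -kerp -adqE.
have DN : {subset D <= killing_radical}.
  exact/subvP/derived_sub0/killing_radical_ideal.
have -> : adq x = 0.
  apply: (@cartan_perfect K K0 L Q adq adq_lie D) => // u v Du Dv.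
  by apply/killing_radicalP/DN.
by rewrite zero_lfunE.
Qed.

(** Let [A] be the last derived ideal of the radical that is not inside [M].
    For [a] in [A], [ad a \o ad y] maps [L] into [A], and
    [A] into [[A, A] <= M]; its square is zero on [L / M]. *)
Lemma radical_sub_of_killing : (killing_radical <= M)%VS -> (radical L <= M)%VS.
Proof.
move=> NM; have [iR [k0 Rk0] _] := radicalP L.
have exk : exists k, (derived k (radical L) <= M)%VS.
  by exists k0; rewrite Rk0 sub0v.
case: (ex_minnP exk) => -[//|k] AM mink.
have /subvP AN : (derived k (radical L) <= killing_radical)%VS; last first.
  suff : (k.+1 <= k)%N by rewrite ltnn.
  by apply: mink; apply: subv_trans NM; apply/subvP.
have iA := @derived_ideal _ _ _ k iR; set A := derived k _ in iA *.
apply/subvP => a Aa; apply/killing_radicalP => y; apply: trace_sqr0.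
apply/lfunP; apply: quot_ind => z.
rewrite !comp_lfunE !adqE zero_lfunE; apply/eqP; rewrite kerp.
apply: (subvP AM); apply: (lieV_sub _ _ _ (subvv _)) => //.
by apply: (iA _ _); rewrite lieC rpredN; apply: iA.
Qed.

End KillingForm.

Section RadicalInvariance.
Variables (K : fieldType) (K0 : [pchar K] =i pred0) (L : finLieAlgType K).

(** An invariant solvable ideal [M] of largest dimension equals the radical of the
    relative Killing form, since the latter is again an
    invariant solvable ideal, and it contains [M]; so [M] is the solvable radical. *)
Theorem radical_invariant (P : {vspace L} -> Prop) :
  P 0%VS ->
  (forall (M : {vspace L}) (Q : vectType K) (p : {linear L -> Q}) (s : {linear Q -> L}),
     is_ideal M -> P M -> cancel s p -> (forall x, (p x == 0) = (x \in M)) ->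
     P (killing_radical p s)) ->
  P (radical L).
Proof.
move=> P0 Pstep.
pose D d := `[< exists M, [/\ is_ideal M, is_solvable M, P M & \dim M = d] >].
have exD : exists d, D d.
  exists 0%N; apply/asboolP; exists 0%VS; split; rewrite ?dimv0 //.
    by move=> x y; rewrite memv0 => /eqP ->; rewrite linear0r mem0v.
  by exists 0%N.
have ubD d : D d -> (d <= \dim {:L})%N.
  by move=> /asboolP[M [_ _ _ <-]]; rewrite dimvS ?subvf.
case: (ex_maxnP exD ubD) => d /asboolP[M [iM sM PM dM]] maxd.
have [Q [p [s [sK kerp]]]] := ex_quotient M.
have MN := ideal_sub_killing_radical iM sK kerp.
have NM : (killing_radical p s <= M)%VS.
  suff /eqP <- : (M == killing_radical p s)%VS by [].
  rewrite eqEdim MN dM; apply: maxd; apply/asboolP; exists (killing_radical p s).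
  split=> //; last exact: Pstep PM sK kerp.
    exact: (killing_radical_ideal iM sK kerp).
  exact: (killing_radical_solvable iM sK kerp K0 sM).
suff -> : radical L = M by [].
apply/eqP; rewrite eqEsubv (radical_sub_of_killing iM sK kerp NM) /=.
by have [_ _ maxR] := radicalP L; apply: maxR.
Qed.
End RadicalInvariance.

(** * Sums in Sweedler notation *)

Section TensorLift.
Variables (K : fieldType) (V W U : lmodType K).

Lemma bilinear_lift (f : V -> W -> U) :
  (forall w, linear (f^~ w)) -> (forall v, linear (f v)) ->
  exists F : {linear V ⊗ W -> U}, forall v w, F (v ⊗ₜ w) = f v w.
Proof.
move=> fl fr.
have fb : bilinear_for *:%R *:%R f by split=> [w|v]; [apply: fl|apply: fr].
pose fB := bilinear_isBilinear.Build K V W U _ _ f fb.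
pose B : {bilinear V -> W -> U} := HB.pack f fB.
by exists (tlift B) => v w; rewrite /= tlift_tens.
Qed.

Lemma sum_repr_lift (f : V -> W -> U) (F : {linear V ⊗ W -> U}) :
  (forall v w, F (v ⊗ₜ w) = f v w) ->
  forall t, \sum_(q <- repr t) f q.1 q.2 = F t.
Proof.
move=> Ff t; rewrite [in RHS](tensor_sum t) linear_sum.
by apply: eq_bigr => q _; rewrite Ff.
Qed.
End TensorLift.

(** Identities in a triple tensor product are used by evaluating trilinear
    maps on them; this is the universal property that allows it. *)
Lemma trilinear_lift (K : fieldType) (V W Z U : lmodType K) (g : V -> W -> Z -> U) :
  (forall w z, linear (fun v => g v w z)) -> (forall v z, linear (fun w => g v w z)) ->
  (forall v w, linear (g v w)) ->
  exists G : {linear V ⊗ (W ⊗ Z) -> U}, forall v w z, G (v ⊗ₜ (w ⊗ₜ z)) = g v w z.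
Proof.
move=> g1 g2 g3.
have /choice[F HF] : forall v, exists F : {linear W ⊗ Z -> U}, forall w z, F (w ⊗ₜ z) = g v w z.
  by move=> v; apply: bilinear_lift.
have [|v|G HG] := @bilinear_lift K V (W ⊗ Z)%type U (fun v => F v).
- move=> t c u v; rewrite -!(sum_repr_lift (HF _)) scaler_sumr -big_split.
  by apply: eq_bigr => q _; apply: g1.
- exact: linearP.
by exists G => v w z; rewrite HG HF.
Qed.

Section Sweedler.
Variables (K : fieldType) (H : hopfAlgType K).
Implicit Types (h k : H).

Lemma sweedler_counitr h : \sum_(q <- repr (comul h)) (counit q.2 : K) *: q.1 = h.
Proof. exact: counitr. Qed.
Lemma sweedler_antipoder h :
  \sum_(q <- repr (comul h)) q.1 * antipode q.2 = (counit h)%:A.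
Proof. exact: antipoder. Qed.

(** The coassociativity axiom evaluated by a trilinear map. Here [r] is either
    a coaction or, for [V = H], the comultiplication. *)
Lemma sweedler_coassoc (V U : lmodType K) (r : {linear V -> V ⊗ H}) (g : V -> H -> H -> U) v :
  tassoc (tmap r idfun (r v)) = tmap idfun comul (r v) ->
  (forall b c, linear (fun a => g a b c)) -> (forall a c, linear (fun b => g a b c)) ->
  (forall a b, linear (g a b)) ->
  \sum_(q <- repr (r v)) \sum_(q' <- repr (r q.1)) g q'.1 q'.2 q.2 =
  \sum_(q <- repr (r v)) \sum_(q' <- repr (comul q.2)) g q.1 q'.1 q'.2.
Proof.
move=> rA g1 g2 g3; have [G HG] := trilinear_lift g1 g2 g3.
pose T : {bilinear V -> H ⊗ H -> V ⊗ (H ⊗ H)} := @tens K V (H ⊗ H).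
transitivity (\sum_(q <- repr (r v)) G (tassoc (tmap r idfun (q.1 ⊗ₜ q.2)))).
  apply: eq_bigr => q _; rewrite tmap_tens /=.
  apply: (@sum_repr_lift _ _ _ _ (fun a b => g a b q.2)
    (G \o (@tassoc _ V H H) \o applyr (@tens K (V ⊗ H) H) q.2)) => a b.
  by rewrite /= tassoc_tens HG.
transitivity (\sum_(q <- repr (r v)) G (tmap idfun comul (q.1 ⊗ₜ q.2))); last first.
  apply: eq_bigr => q _; rewrite tmap_tens /=.
  apply: esym. apply: (@sum_repr_lift _ _ _ _ (g q.1) (G \o T q.1)) => a b.
  by rewrite /= HG.
rewrite (@sum_repr_lift _ _ _ _ (fun a b => G (tassoc (tmap r idfun (a ⊗ₜ b))))
  (G \o (@tassoc _ V H H) \o tmap r idfun)) //.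
rewrite (@sum_repr_lift _ _ _ _ (fun a b => G (tmap idfun comul (a ⊗ₜ b)))
  (G \o tmap idfun comul)) //.
by rewrite /= rA.
Qed.
End Sweedler.

(** * Module Lie algebras *)

Section ModuleLie.
Variables (K : fieldType) (H : hopfAlgType K) (L : finLieAlgType K) (a : hmodule H L).
Hypothesis aL : hmodule_lie a.
Implicit Types (h k : H) (x y z : L).

Lemma act_lie h x y :
  a h (lie x y) = \sum_(q <- repr (comul h)) lie (a q.1 x) (a q.2 y).
Proof.
have := aL h (x ⊗ₜ y); rewrite /bracket /diag_act tlift_tens => <-.
rewrite [comul h in LHS]tensor_sum linear_sumlz linear_sum.
by apply: eq_bigr => q _; rewrite /= tmap2_tens tlift_tens.
Qed.

Lemma comul_coassoc h (U : lmodType K) (g : H -> H -> H -> U) :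
  (forall b c, linear (fun a => g a b c)) -> (forall a c, linear (fun b => g a b c)) ->
  (forall a b, linear (g a b)) ->
  \sum_(q <- repr (comul h)) \sum_(q' <- repr (comul q.1)) g q'.1 q'.2 q.2 =
  \sum_(q <- repr (comul h)) \sum_(q' <- repr (comul q.2)) g q.1 q'.1 q'.2.
Proof. by move=> *; apply: (@sweedler_coassoc _ H H _ comul) => //; apply: comulA. Qed.

Lemma act_antipode k z :
  \sum_(q <- repr (comul k)) a q.1 (a (antipode q.2) z) = (counit k : K) *: z.
Proof.
under eq_bigr do rewrite -hactM.
by rewrite -linear_sumlz sweedler_antipoder linearZl_LR /= hact1.
Qed.

(** Equivariance of [ad : L -> End(L)]:
    [h_1 [y, S(h_2) z] = [h_1 y, h_2 S(h_3) z] = [h y, z]]. *)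
Lemma act_ad k y z :
  \sum_(q <- repr (comul k)) a q.1 (lie y (a (antipode q.2) z)) = lie (a k y) z.
Proof.
under eq_bigr do rewrite act_lie.
rewrite (@comul_coassoc _ _ (fun b c d => lie (a b y) (a c (a (antipode d) z)))).
- under eq_bigr do rewrite -linear_sumr act_antipode linearZr_LR -linearZl_LR -linearZl_LR.
  by rewrite -linear_sumlz -linear_sumlz sweedler_counitr.
- by move=> c d e u v; rewrite !linearPl.
- by move=> b d e u v; rewrite linearPl linearPr.
- by move=> b c e u v; rewrite linearP linearPl !linearPr.
Qed.

(** Equivariance of [ad x \o ad y]:
    [h_1 [x, [y, S(h_2) z]] = [h_1 x, h_2 [y, S(h_3) z]] = [h_1 x, [h_2 y, z]]]. *)
Lemma act_ad2 h x y z :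
  \sum_(q <- repr (comul h)) a q.1 (lie x (lie y (a (antipode q.2) z))) =
  \sum_(q <- repr (comul h)) lie (a q.1 x) (lie (a q.2 y) z).
Proof.
under eq_bigr do rewrite act_lie.
rewrite (@comul_coassoc _ _ (fun b c d => lie (a b x) (a c (lie y (a (antipode d) z))))).
- by apply: eq_bigr => q _; rewrite -linear_sumr act_ad.
- by move=> c d e u v; rewrite !linearPl.
- by move=> b d e u v; rewrite linearPl linearPr.
- by move=> b c e u v; rewrite linearP linearPl !linearPr.
Qed.

Section Quotient.
Variables (M : {vspace L}) (Q : vectType K) (p : {linear L -> Q}) (s : {linear Q -> L}).
Hypotheses (idM : is_ideal M) (invM : hinvariant a M).
Hypotheses (sK : cancel s p) (kerp : forall x, (p x == 0) = (x \in M)).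

Definition quot_act h (q : Q) : Q := p (a h (s q)).

Lemma quot_act_is_bilinear : bilinear_for *:%R *:%R quot_act.
Proof. by split=> [q c u v|h c u v]; rewrite /quot_act ?linearPl linearP //= !linearP. Qed.
HB.instance Definition _ := bilinear_isBilinear.Build K H Q Q _ _ quot_act quot_act_is_bilinear.

Lemma quot_actE h x : quot_act h (p x) = p (a h x).
Proof.
rewrite /quot_act; have [m Mm ->] := quot_split sK kerp x.
by rewrite linearDr linearD /=; have /eqP-> : p (a h m) == 0; rewrite ?addr0 // kerp invM.
Qed.

Lemma quot_act1 q : quot_act 1 q = q.
Proof. by rewrite /quot_act hact1 sK. Qed.

Lemma quot_actM h k q : quot_act (h * k) q = quot_act h (quot_act k q).
Proof. by rewrite -(sK q) !quot_actE hactM. Qed.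

Definition quot_hmodule : hmodule H Q := HModule quot_act1 quot_actM.

Lemma quot_end_act h x y :
  end_act quot_hmodule h (adq p s x \o adq p s y)%VF =
  \sum_(q <- repr (comul h)) (adq p s (a q.1 x) \o adq p s (a q.2 y))%VF.
Proof.
apply/lfunP; apply: (quot_ind sK) => z.
rewrite /end_act /tlift /teval !sum_lfunE.
transitivity (p (\sum_(q <- repr (comul h)) a q.1 (lie x (lie y (a (antipode q.2) z))))).
  rewrite linear_sum; apply: eq_bigr => q _.
  have actE h' v : linfun (quot_hmodule h') v = quot_act h' v by rewrite lfunE.
  rewrite /bicomp /= /sandwich !comp_lfunE !actE.
  by rewrite quot_actE !(adqE idM sK kerp) quot_actE.
rewrite act_ad2 linear_sum; apply: eq_bigr => q _.
by rewrite comp_lfunE !(adqE idM sK kerp).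
Qed.

Hypothesis trQ : hmodule_tracial quot_hmodule.

(** Traciality of [L / M] makes the relative Killing form invariant. *)
Lemma killing_act h x y :
  \sum_(q <- repr (comul h)) killing p s (a q.1 x) (a q.2 y) = counit h * killing p s x y.
Proof. by have := trQ h (adq p s x \o adq p s y)%VF; rewrite quot_end_act linear_sum. Qed.

(** [kappa (h x) y = kappa (h_1 x) (h_2 S(h_3) y) = eps(h_1) kappa x (S(h_2) y)],
    and the last expression is zero for [x] in the radical of [kappa]. *)
Lemma killing_radical_hinvariant : hinvariant a (killing_radical p s).
Proof.
move=> h x /killing_radicalP Nx; apply/killing_radicalP => y.
transitivity (\sum_(q <- repr (comul h)) killing p s (a q.1 x) ((counit q.2 : K) *: y)).
  rewrite -{1}(sweedler_counitr h) linear_sumlz linear_sumlz.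
  by apply: eq_bigr => q _ /=; rewrite !linearZl_LR linearZr_LR.
under eq_bigr do rewrite -act_antipode linear_sumr.
rewrite -(@comul_coassoc h K^o (fun b c d => killing p s (a b x) (a c (a (antipode d) y)))).
- by rewrite big1 // => q _; rewrite killing_act Nx mulr0.
- by move=> c d e u v; rewrite !linearPl.
- by move=> b d e u v; rewrite linearPl linearPr.
- by move=> b c e u v; rewrite linearP linearPl !linearPr.
Qed.
End Quotient.

Theorem radical_hinvariant (K0 : [pchar K] =i pred0) :
  hmodule_coher_tracial a -> hinvariant a (radical L).
Proof.
move=> trL; apply: (radical_invariant K0) => [h x|M Q p s idM invM sK kerp].
  by rewrite !memv0 => /eqP->; rewrite linear0r.
apply: (@killing_radical_hinvariant M Q p s idM invM sK kerp).
apply: (trL _ _ p) => [h x|q]; first by rewrite /= (quot_actE invM sK kerp).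
by exists (s q).
Qed.
End ModuleLie.

(** * Comodule Lie algebras *)

Lemma tmap_sum (K : fieldType) (A B V W : lmodType K)
  (f : {linear A -> V}) (g : {linear B -> W}) t :
  tmap f g t = \sum_(q <- repr t) f q.1 ⊗ₜ g q.2.
Proof.
by rewrite [in LHS](tensor_sum t) linear_sum; apply: eq_bigr => q _; rewrite /= tmap_tens.
Qed.

(** Let [F] be the map whose kernel is [W] and [G] a section of [F] on its image. Then
    [v - G (F v)] projects onto [W], and the correction [G (F v)], a combination of the
    given functionals, contributes nothing to [t]. *)
Lemma in_tensorl_of_functionals (K : fieldType) (H : hopfAlgType K) (V : vectType K)
  (W : {vspace V}) n (f : {linear V -> 'rV[K]_n}) (t : V ⊗ H) :
  (forall v, (v \in W) = (f v == 0)) ->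
  (forall j, \sum_(q <- repr t) f q.1 0 j *: q.2 = 0) -> in_tensorl W t.
Proof.
move=> Wf tf; pose F := linfun f.
have FE v : F v = f v by rewrite lfunE.
pose u j := (F^-1)%VF (delta_mx 0 j).
pose pr v := v - (F^-1)%VF (F v).
have pr_lin : linear pr.
  by move=> c x y; rewrite /pr (linearP F) (linearP (F^-1)%VF) scalerBr opprD addrACA.
have prW v : pr v \in W.
  by rewrite Wf -FE linearB /= limg_lfunVK ?memv_img ?memvf // subrr.
pose prL : {linear V -> V} := HB.pack pr (GRing.isLinear.Build K V V _ pr pr_lin).
exists (tmap (@vsproj _ _ W \o prL) idfun t).
rewrite [in RHS](tmap_sum (_ \o _)) linear_sum /=.
under eq_bigr do rewrite tmap_tens /= vsprojK // linearBl /=.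
rewrite sumrB -tensor_sum; apply/eqP; rewrite -subr_eq0 opprB addrC subrK; apply/eqP.
transitivity (\sum_j u j ⊗ₜ (\sum_(q <- repr t) f q.1 0 j *: q.2)); last first.
  by rewrite big1 // => j _; rewrite tf linear0r.
under [RHS]eq_bigr do rewrite linear_sumr.
rewrite exchange_big; apply: eq_bigr => q _.
rewrite FE {1}[f q.1]row_sum_delta linear_sum linear_sumlz; apply: eq_bigr => j _ /=.
by rewrite linearZ /= linearZl_LR linearZr_LR.
Qed.

Section ComoduleLie.
Variables (K : fieldType) (H : hopfAlgType K) (L : finLieAlgType K) (r : hcomodule H L).
Hypothesis rL : hcomodule_lie r.
Implicit Types (h k : H) (x y z : L).

Lemma coact_lie x y :
  r (lie x y) = \sum_(a <- repr (r x)) \sum_(b <- repr (r y))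
                  lie a.1 b.1 ⊗ₜ (a.2 * b.2).
Proof.
have := rL (x ⊗ₜ y); rewrite /bracket /diag_coact !tlift_tens => <-.
rewrite /bicomp /= [r x in LHS]tensor_sum [r y in LHS]tensor_sum linear_sumlz linear_sum.
apply: eq_bigr => a _; rewrite linear_sumr linear_sum; apply: eq_bigr => b _ /=.
by rewrite tmap2_tens tmap_tens /= /bracket tlift_tens.
Qed.
 
Lemma sum_coact_lie (U : lmodType K) (f : L -> H -> U) x y :
  (forall w, linear (f^~ w)) -> (forall v, linear (f v)) ->
  \sum_(q <- repr (r (lie x y))) f q.1 q.2 =
  \sum_(a <- repr (r x)) \sum_(b <- repr (r y)) f (lie a.1 b.1) (a.2 * b.2).
Proof.
move=> fl fr; have [F HF] := bilinear_lift fl fr.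
rewrite (sum_repr_lift HF) coact_lie linear_sum; apply: eq_bigr => a _.
by rewrite linear_sum; apply: eq_bigr => b _; rewrite HF.
Qed.

Lemma coact_coassoc z (U : lmodType K) (g : L -> H -> H -> U) :
  (forall b c, linear (fun a => g a b c)) -> (forall a c, linear (fun b => g a b c)) ->
  (forall a b, linear (g a b)) ->
  \sum_(q <- repr (r z)) \sum_(q' <- repr (r q.1)) g q'.1 q'.2 q.2 =
  \sum_(q <- repr (r z)) \sum_(q' <- repr (comul q.2)) g q.1 q'.1 q'.2.
Proof. by move=> *; apply: (@sweedler_coassoc _ H L _ r) => //; apply: hcoactA. Qed.

Lemma coact_counit z : \sum_(q <- repr (r z)) (counit q.2 : K) *: q.1 = z.
Proof. exact: hcoact_counit. Qed.

(** Equivariance of [ad x \o ad y] for the coactions: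
    [[x_0, [y_0, z_0]] (x) x_1 y_1 z_1 S(z_2) = [x_0, [y_0, z]] (x) x_1 y_1],
    evaluated by an arbitrary bilinear map [f]. *)
Lemma coact_ad2 (U : lmodType K) (f : L -> H -> U) x y z :
  (forall w, linear (f^~ w)) -> (forall v, linear (f v)) ->
  \sum_(q <- repr (r z)) \sum_(w <- repr (r (lie x (lie y q.1)))) f w.1 (w.2 * antipode q.2) =
  \sum_(a <- repr (r x)) \sum_(b <- repr (r y)) f (lie a.1 (lie b.1 z)) (a.2 * b.2).
Proof.
move=> fl fr.
under eq_bigr => q _.
  rewrite (@sum_coact_lie _ (fun u h => f u (h * antipode q.2))); last 2 first.
  - by move=> w c u v; rewrite fl.
  - by move=> v c h k; rewrite mulrDl -scalerAl fr.
  under eq_bigr => a _.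
    rewrite (@sum_coact_lie _ (fun u h => f (lie a.1 u) (a.2 * h * antipode q.2))); last 2 first.
    - by move=> w c u v; rewrite linearPr fl.
    - by move=> v c h k; rewrite mulrDr mulrDl -scalerAr -scalerAl fr.
    over.
  over.
rewrite exchange_big; apply: eq_bigr => a _ /=.
rewrite exchange_big; apply: eq_bigr => b _ /=.
rewrite (@coact_coassoc _ _
    (fun u h k => f (lie a.1 (lie b.1 u)) (a.2 * (b.2 * h) * antipode k))).
- transitivity (\sum_(q <- repr (r z)) (counit q.2 : K) *: f (lie a.1 (lie b.1 q.1)) (a.2 * b.2)).
    apply: eq_bigr => q _.
    have frL := fr (lie a.1 (lie b.1 q.1)).
    pose F : {linear H -> U} := HB.pack (f (lie a.1 (lie b.1 q.1)))
      (GRing.isLinear.Build K H U _ _ frL).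
    under eq_bigr do rewrite mulrA -mulrA.
    rewrite -[LHS](linear_sum F) /= -mulr_sumr sweedler_antipoder -scalerAr mulr1.
    exact: (linearZ_LR F).
  pose F : {linear L -> U} := HB.pack (f^~ (a.2 * b.2))
    (GRing.isLinear.Build K L U _ _ (fl _)).
  rewrite -[in RHS](coact_counit z) linear_sumr linear_sumr [RHS](linear_sum F).
  by apply: eq_bigr => q _; rewrite !linearZr_LR [RHS](linearZ_LR F).
- by move=> h k c u v; rewrite !linearPr fl.
- by move=> u k c h h'; rewrite !mulrDr mulrDl -!scalerAr -scalerAl fr.
- by move=> u h c k k'; rewrite linearP mulrDr -scalerAr fr.
Qed.

Section Quotient.
Variables (M : {vspace L}) (Q : vectType K) (p : {linear L -> Q}) (s : {linear Q -> L}).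
Hypotheses (idM : is_ideal M) (coM : hcoinvariant r M).
Hypotheses (sK : cancel s p) (kerp : forall x, (p x == 0) = (x \in M)).

Definition quot_coact (q : Q) : Q ⊗ H := tmap p idfun (r (s q)).

Lemma quot_coact_is_linear : linear quot_coact.
Proof. by move=> c u v; rewrite /quot_coact !linearP. Qed.
HB.instance Definition _ := GRing.isLinear.Build K Q (Q ⊗ H)%type _
  quot_coact quot_coact_is_linear.

Lemma quot_coactE x : quot_coact (p x) = tmap p idfun (r x).
Proof.
rewrite /quot_coact; have [m Mm ->] := quot_split sK kerp x.
rewrite !linearD /= [X in _ + X](_ : _ = 0) ?addr0 //.
have [t ->] := coM Mm; rewrite (tmap_sum _ _ t) linear_sum big1 // => q _ /=.
rewrite tmap_tens /=; have /eqP-> : p (vsval q.1) == 0 by rewrite kerp subvsP.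
exact: linear0l.
Qed.

Lemma sum_quot_coact (U : lmodType K) (f : Q -> H -> U) x :
  (forall w, linear (f^~ w)) -> (forall v, linear (f v)) ->
  \sum_(q <- repr (quot_coact (p x))) f q.1 q.2 = \sum_(q <- repr (r x)) f (p q.1) q.2.
Proof.
move=> fl fr; have [F HF] := bilinear_lift fl fr.
rewrite (sum_repr_lift HF) quot_coactE tmap_sum linear_sum.
by apply: eq_bigr => q _; rewrite /= HF.
Qed.

Lemma quot_coactA q :
  tassoc (tmap quot_coact idfun (quot_coact q)) = tmap idfun comul (quot_coact q).
Proof.
rewrite -(sK q); set x := s q.
pose T : {bilinear Q -> H ⊗ H -> Q ⊗ (H ⊗ H)} := @tens K Q (H ⊗ H).
pose T1 : {bilinear Q ⊗ H -> H -> (Q ⊗ H) ⊗ H} := @tens K (Q ⊗ H) H.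
have assocE (t : Q ⊗ H) h :
    tassoc (t ⊗ₜ h) = \sum_(c <- repr t) c.1 ⊗ₜ (c.2 ⊗ₜ h).
  apply: esym; apply: (@sum_repr_lift _ _ _ _ (fun a b => a ⊗ₜ (b ⊗ₜ h))
    ((@tassoc _ Q H H) \o applyr T1 h)) => a b.
  by rewrite /= tassoc_tens.
transitivity (\sum_(w <- repr (r x)) \sum_(c <- repr (r w.1)) p c.1 ⊗ₜ (c.2 ⊗ₜ w.2)).
  rewrite tmap_sum linear_sum /=.
  rewrite (@sum_quot_coact _ (fun u h => tassoc (quot_coact u ⊗ₜ h))).
  - apply: eq_bigr => w _; rewrite assocE.
    rewrite (@sum_quot_coact _ (fun u h => u ⊗ₜ (h ⊗ₜ w.2))) //.
      by move=> h; apply: linearPl.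
    by move=> u c h k; rewrite linearPl linearPr.
  - by move=> h c u v; rewrite linearP linearPl linearP.
  - by move=> u c h k; rewrite linearPr linearP.
rewrite tmap_sum (@sum_quot_coact _ (fun u h => u ⊗ₜ comul h)); last 2 first.
- by move=> h; apply: linearPl.
- by move=> u c h k; rewrite linearP linearPr.
rewrite (@coact_coassoc _ _
    (fun u h k => p u ⊗ₜ (h ⊗ₜ k))).
- apply: eq_bigr => w _.
  by rewrite [comul w.2 in RHS]tensor_sum linear_sumr.
- by move=> h k c u v; rewrite linearP linearPl.
- by move=> u k c h h'; rewrite linearPl linearPr.
- by move=> u h c k k'; rewrite linearPr linearPr.
Qed.

Lemma quot_coact_counit q :
  tlift (bicomp (@scaler K Q) idfun counit) (quot_coact q) = q.
Proof.
rewrite -(sK q); set x := s q.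
transitivity (\sum_(w <- repr (r x)) (counit w.2 : K) *: p w.1); last first.
  rewrite -[in RHS](coact_counit x) linear_sum.
  by apply: eq_bigr => w _; rewrite linearZ.
apply: (@sum_quot_coact _ (bicomp (@scaler K Q) idfun counit)) => [w|v].
  exact: linearPl.
exact: linearPr.
Qed.

Definition quot_hcomodule : hcomodule H Q := HComodule quot_coactA quot_coact_counit.

Lemma dyad_sum (T : 'End(Q)) : \sum_i dyad i (T (vbasis {:Q})`_i) = T.
Proof.
apply/lfunP => v; rewrite sum_lfunE [in RHS](coord_vbasis (memvf v)) linear_sum.
by apply: eq_bigr => i _; rewrite dyadE linearZ.
Qed.

(** This is an identity in [End(Q) (x) H]; since [end_coact] is
    assembled from its values on a basis, it follows from the identity at each
    vector, which is [coact_ad2]. *)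
Lemma quot_end_coact x y :
  end_coact quot_hcomodule (adq p s x \o adq p s y)%VF =
  \sum_(a <- repr (r x)) \sum_(b <- repr (r y))
    (adq p s a.1 \o adq p s b.1)%VF ⊗ₜ (a.2 * b.2).
Proof.
have at_E q : end_coact_at quot_hcomodule (adq p s x \o adq p s y)%VF q =
  \sum_(a <- repr (r x)) \sum_(b <- repr (r y))
    (adq p s a.1 \o adq p s b.1)%VF q ⊗ₜ (a.2 * b.2).
  elim/(quot_ind sK): q => z.
  rewrite /end_coact_at [LHS](@sum_quot_coact _ (bicomp _ _ _)); last 2 first.
  - by move=> w; apply: linearPl.
  - by move=> v; apply: linearPr.
  transitivity (\sum_(w <- repr (r z)) \sum_(c <- repr (r (lie x (lie y w.1))))
                  p c.1 ⊗ₜ (c.2 * antipode w.2)).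
    apply: eq_bigr => w _; rewrite /bicomp /= comp_lfunE !(adqE idM sK kerp).
    rewrite /rmulT tmap_sum (@sum_quot_coact _ (fun u h => u ⊗ₜ (h * antipode w.2))) //.
      by move=> h; apply: linearPl.
    by move=> u c h k; rewrite mulrDl -scalerAl linearPr.
  rewrite (@coact_ad2 _ (fun u h => p u ⊗ₜ h)); last 2 first.
  - by move=> h c u v; rewrite linearP linearPl.
  - by move=> u; apply: linearPr.
  apply: eq_bigr => a _; apply: eq_bigr => b _.
  by rewrite comp_lfunE !(adqE idM sK kerp).
rewrite /end_coact.
under eq_bigr => i _.
  rewrite at_E linear_sum; under eq_bigr => a _.
    rewrite linear_sum; under eq_bigr => b _ do rewrite /= tmap_tens.
    over.
  over.
rewrite exchange_big; apply: eq_bigr => a _.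
rewrite exchange_big; apply: eq_bigr => b _ /=.
by rewrite -linear_sumlz dyad_sum.
Qed.

Hypothesis trQ : hcomodule_tracial quot_hcomodule.

(** Traciality of [L / M] makes the relative Killing form coinvariant. *)
Lemma killing_coact x y :
  \sum_(a <- repr (r x)) \sum_(b <- repr (r y)) (killing p s a.1 b.1 : K) *: (a.2 * b.2) =
  (killing p s x y : K) *: 1.
Proof.
have := trQ (adq p s x \o adq p s y)%VF; rewrite quot_end_coact.
move/(congr1 (tlift (@scalel K H))); rewrite tlift_tens => /esym E; apply/esym/(etrans E).
pose F : {linear 'End(Q) ⊗ H -> H} :=
  tlift (@scalel K H) \o tmap (@trace K Q) idfun.
have FE T h : F (T ⊗ₜ h) = (trace T : K) *: h by rewrite /F /= tmap_tens tlift_tens.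
rewrite -[LHS]/(F _) (linear_sum F); apply: eq_bigr => a _.
by rewrite (linear_sum F); apply: eq_bigr => b _; rewrite FE.
Qed.

(** Both sides equal [kappa (x_0) (y_0) x_1 y_1 S(y_2)]: on the left the product
    [y_1 S(y_2)] collapses, on the right [kappa (x_0) (y_0) x_1 y_1] does. *)
Lemma killing_coact_adjoint x y :
  \sum_(a <- repr (r x)) (killing p s a.1 y : K) *: a.2 =
  \sum_(b <- repr (r y)) (killing p s x b.1 : K) *: antipode b.2.
Proof.
transitivity (\sum_(a <- repr (r x)) \sum_(b <- repr (r y)) \sum_(c <- repr (comul b.2))
                (killing p s a.1 b.1 : K) *: (a.2 * (c.1 * antipode c.2))).
  apply: eq_bigr => a _.
  rewrite -{1}(coact_counit y) linear_sumr scaler_suml.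
  apply: eq_bigr => b _; rewrite -scaler_sumr -mulr_sumr sweedler_antipoder.
  by rewrite -scalerAr mulr1 scalerA linearZr_LR mulrC.
transitivity (\sum_(b <- repr (r y)) \sum_(a <- repr (r x)) \sum_(c <- repr (r b.1))
                (killing p s a.1 c.1 : K) *: (a.2 * (c.2 * antipode b.2))).
  rewrite [RHS]exchange_big; apply: eq_bigr => a _ /=.
  rewrite (@coact_coassoc _ _
    (fun u h k => (killing p s a.1 u : K) *: (a.2 * (h * antipode k)))) //.
  - by move=> h k c u v; rewrite linearPr scalerDl scalerA.
  - by move=> u k c h h'; rewrite mulrDl mulrDr -scalerAl -scalerAr scalerDr !scalerA mulrC.
  - by move=> u h c k k'; rewrite linearP !mulrDr -!scalerAr scalerDr !scalerA mulrC.
apply: eq_bigr => b _; rewrite -[RHS]mul1r -scalerAr scalerAl -killing_coact mulr_suml.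
apply: eq_bigr => a _; rewrite mulr_suml; apply: eq_bigr => c _.
by rewrite -scalerAl mulrA.
Qed.

Lemma killing_radical_hcoinvariant : hcoinvariant r (killing_radical p s).
Proof.
move=> x /killing_radicalP Nx.
apply: (@in_tensorl_of_functionals _ _ _ _ _ (killing_pairing p s)) => [v|j].
  by rewrite memv_ker lfunE.
under eq_bigr do rewrite mxE.
by rewrite killing_coact_adjoint big1 // => b _; rewrite Nx scale0r.
Qed.
End Quotient.

Theorem radical_hcoinvariant (K0 : [pchar K] =i pred0) :
  hcomodule_coher_tracial r -> hcoinvariant r (radical L).
Proof.
move=> trL; apply: (radical_invariant K0) => [x|M Q p s idM coM sK kerp].
  by rewrite memv0 => /eqP->; exists 0; rewrite !linear0.
apply: (@killing_radical_hcoinvariant M Q p s idM coM sK kerp).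
apply: (trL _ _ p) => [x|q]; first by rewrite /= (quot_coactE coM sK kerp).
by exists (s q).
Qed.
End ComoduleLie.

Theorem theorem0p4 (K : fieldType) (K0 : [pchar K]%R =i pred0)
  (H : hopfAlgType K) (L : finLieAlgType K) :
  (forall a : hmodule H L,
     hmodule_lie a -> hmodule_coher_tracial a -> hinvariant a (radical L)) /\
  (forall r : hcomodule H L,
     hcomodule_lie r -> hcomodule_coher_tracial r -> hcoinvariant r (radical L)).
Proof.
split=> [a aL trL|r rL trL]; first exact: radical_hinvariant aL K0 trL.
exact: radical_hcoinvariant rL K0 trL.
Qed.
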